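(* Let $n\geq 1$. The assignment $J\mapsto \mathrm{SU}J$ induces a bijection from $\hat{\mathrm{K}}(n)$ onto the set $\mathrm{Howe}(\mathrm{SU}(n))$ of conjugacy classes of Howe subgroups of $\mathrm{SU}(n)$.
   Context: A subgroup $H$ of a group $G$ is a Howe subgroup iff $H=\mathrm{C}_G(K)$ (centralizer) for some subset $K\subseteq G$. $\mathrm{K}(n)$ is the set of pairs $J=(\mathbf{k},\mathbf{m})=((k_1,\dots,k_r),(m_1,\dots,m_r))$ of sequences of positive integers of equal length $r\in\{1,\dots,n\}$ with $\sum_{i=1}^r k_im_i=n$. For $J\in\mathrm{K}(n)$, the decomposition $\mathbb{C}^n=\bigoplus_{i=1}^r\mathbb{C}^{k_i}\otimes\mathbb{C}^{m_i}$ induces the injective homomorphism $\prod_i\mathrm{gl}(k_i,\mathbb{C})\to\mathrm{gl}(n,\mathbb{C})$, $(D_1,\dots,D_r)\mapsto\bigoplus_i D_i\otimes 1_{m_i}$; its image is denoted $\mathrm{gl}(J,\mathbb{C})$ and $\mathrm{SU}J=\mathrm{gl}(J,\mathbb{C})\cap\mathrm{SU}(n)$. For a permutation $\sigma$ of $\{1,\dots,r\}$, $\sigma J=(\sigma\mathbf{k},\sigma\mathbf{m})$ is obtained by applying $\sigma$ simultaneously to both sequences. $J\sim J'$ iff $J'=\sigma J$ for some $\sigma$; $\hat{\mathrm{K}}(n)=\mathrm{K}(n)/\!\sim$. *)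

(* Defs.v *)
From HB Require Import structures.
From mathcomp Require Import all_boot all_order all_fingroup all_algebra.
From mathcomp Require Import character generic_quotient.
From mathcomp Require Import classical_sets functions reals complex.

Set Implicit Arguments.
Unset Strict Implicit.
Unset Printing Implicit Defensive.

Import GRing.Theory.
Local Open Scope classical_set_scope.
Local Open Scope quotient_scope.
Local Open Scope ring_scope.
Local Open Scope complex_scope.

Section Howe.
Variable G : groupType.
Implicit Types (H K : set G) (g : G).

Definition subgroup H : Prop := group_closed (mem H).

Definition centralizer K : set G := [set g | forall h, K h -> commute g h].

Definition Howe_subgroup H : Prop :=
  subgroup H /\ exists K, H = centralizer K.

(* [conjg h g] is g^-1 * h * g. *)
Definition conj_set H g : set G := [set conjg h g | h in H].

Definition conj_class H : set (set G) := range (conj_set H).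

Definition Howe : set (set (set G)) :=
  [set conj_class H | H in [set H | Howe_subgroup H]].

End Howe.

Arguments Howe G : clear implicits.

Section SpecialUnitary.
Variables (R : realType) (n : nat).

Definition is_SU (A : 'M[R[i]]_n) : bool := (A \is unitarymx) && (\det A == 1).

Record SU := MkSU { SU_val :> 'M[R[i]]_n; SU_valP : is_SU SU_val }.

HB.instance Definition _ := [isSub for SU_val].
HB.instance Definition _ := [Choice of SU by <:].

Lemma is_SU1 : is_SU 1%:M.
Proof.
apply/andP; split; last by rewrite det1.
by apply/unitarymxP; rewrite mul1mx trmx1 map_mx1.
Qed.

Lemma is_SUM (A B : SU) : is_SU (A *m B).
Proof.
case: A B => [A /andP[uA /eqP dA]] [B /andP[uB /eqP dB]] /=.
by rewrite /is_SU mul_unitarymx //= det_mulmx dA dB mul1r.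
Qed.

Lemma is_SUV (A : SU) : is_SU (invmx A).
Proof.
case: A => [A /andP[uA /eqP dA]] /=.
by rewrite /is_SU det_inv dA invr1 eqxx andbT invmx_unitary ?trmxC_unitary.
Qed.

Lemma SU_unit (A : SU) : SU_val A \in unitmx.
Proof. by case: A => A AP; have /andP[/unitarymx_unit] := AP. Qed.

Let one := MkSU is_SU1.
Let mul A B := MkSU (is_SUM A B).
Let inv A := MkSU (is_SUV A).

Let mulA : associative mul.
Proof. by move=> A B C; apply/val_inj; exact: mulmxA. Qed.
Let mul1 : left_id one mul.
Proof. by move=> A; apply/val_inj; exact: mul1mx. Qed.
Let mulr1 : right_id one mul.
Proof. by move=> A; apply/val_inj; exact: mulmx1. Qed.
Let mulV : left_inverse one inv mul.
Proof. by move=> A; apply/val_inj; exact: mulVmx (SU_unit A). Qed.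
Let mulrV : right_inverse one inv mul.
Proof. by move=> A; apply/val_inj; exact: mulmxV (SU_unit A). Qed.

HB.instance Definition _ := isGroup.Build SU mulA mul1 mulr1 mulV mulrV.

End SpecialUnitary.

Section Multiplicities.
Variable n : nat.

(* The pairs (k, m) of sequences; [all (leq 1)] is positivity of the terms. *)
Definition is_K (J : seq nat * seq nat) : bool :=
  [&& size J.1 == size J.2, (1 <= size J.1 <= n)%N,
      all (leq 1) J.1, all (leq 1) J.2 &
      (\sum_(i < size J.1) nth 0 J.1 i * nth 0 J.2 i == n)%N].

Record K := MkK { K_val :> seq nat * seq nat; K_valP : is_K K_val }.

HB.instance Definition _ := [isSub for K_val].
HB.instance Definition _ := [Countable of K by <:].

Definition K_len (J : K) : nat := size (K_val J).1.
Definition K_k (J : K) (i : 'I_(K_len J)) : nat := nth 0%N (K_val J).1 i.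
Definition K_m (J : K) (i : 'I_(K_len J)) : nat := nth 0%N (K_val J).2 i.

Lemma K_sum (J : K) : (\sum_(i < K_len J) K_k i * K_m i)%N = n.
Proof. by case: J => J JP; have /and5P[_ _ _ _ /eqP] := JP. Qed.

Definition K_perm (J : K) (s : 'S_(K_len J)) : seq nat * seq nat :=
  ([seq K_k (s i) | i : 'I_(K_len J)], [seq K_m (s i) | i : 'I_(K_len J)]).

Definition K_sim (J J' : K) : bool :=
  [exists s : 'S_(K_len J), K_val J' == K_perm s].

Lemma K_simE (J J' : K) :
  K_sim J J' = perm_eq (zip (K_val J').1 (K_val J').2)
                       (zip (K_val J).1 (K_val J).2).
Proof.
have szE (I : K) : size (K_val I).1 = size (K_val I).2.
  by case: I => I IP; have /and5P[/eqP] := IP.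
have szz : size (zip (K_val J).1 (K_val J).2) = K_len J.
  by rewrite size1_zip // szE.
pose t : (K_len J).-tuple (nat * nat) := Tuple (introT eqP szz).
have tE i : tnth t i = (K_k i, K_m i).
  by rewrite (tnth_nth (0, 0)%N) /= nth_zip ?szE.
have zE (s : 'S_(K_len J)) :
    zip (K_perm s).1 (K_perm s).2 = [tuple tnth t (s i) | i < K_len J].
  by rewrite /K_perm /= /image_mem zip_map; apply: eq_map => i; rewrite tE.
apply/idP/idP => [/existsP[s /eqP->]|/(@tuple_permP _ _ _ t)[s sE]].
  by rewrite zE; apply/(@tuple_permP _ _ _ t); exists s.
apply/existsP; exists s.
rewrite -zE in sE; apply/eqP.
rewrite [LHS]surjective_pairing [RHS]surjective_pairing.
have szp : size (K_perm s).1 = size (K_perm s).2 by rewrite !size_map.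
have eq1 := congr1 unzip1 sE; have eq2 := congr1 unzip2 sE.
rewrite !unzip1_zip ?szp ?szE // in eq1.
by rewrite !unzip2_zip ?szp ?szE // in eq2; rewrite eq1 eq2.
Qed.

Lemma K_sim_equiv : equiv_class_of K_sim.
Proof.
split=> [J|J J'|J' J J'']; rewrite !K_simE //; first exact: perm_sym.
by move=> J'J JJ''; exact: perm_trans JJ'' J'J.
Qed.

Canonical K_sim_rel := EquivRelPack K_sim_equiv.

Definition Khat := {eq_quot K_sim_rel}.

Definition Khat_pi (J : K) : Khat := \pi_Khat J.

End Multiplicities.

Section SUJ.
Variables (R : realType) (n : nat) (J : K n).

(* [tprod] is the Kronecker product, so the standard basis of C^n is identified
   with that of the direct sum of the C^(k_i) (x) C^(m_i) by ordering the latter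
   by summand and lexicographically within each summand. *)
Definition gl_emb (D : forall i : 'I_(K_len J), 'M[R[i]]_(K_k i)) :
    'M[R[i]]_n :=
  castmx (K_sum J, K_sum J)
    (\mxdiag_(i < K_len J) tprod (D i) (1%:M : 'M_(K_m i))).

Definition gl_J : set 'M[R[i]]_n := range gl_emb.

Definition SU_J : set (SU R n) := [set g | gl_J (SU_val g)].

End SUJ.

Arguments SU_J R {n} J.

(* Main.v *)
(* A Howe subgroup is the set of special unitary elements of the commutant of a
   self-adjoint set S of matrices.  Splitting C^n orthogonally into irreducible
   S-invariant subspaces and grouping the isomorphic ones gives an orthonormal
   basis e_{i,a,b} (block i < r, copy a < k_i, coordinate b < m_i in the
   irreducible) in which S acts on the index b only; by Schur's lemma the
   commutant consists of the matrices acting on the index a only, i.e. it is a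
   unitary conjugate of gl(J).  Conversely gl(J) is the commutant of the
   algebra acting on the index b.  Cayley transforms, rescaled to determinant 1,
   show that a self-adjoint commutant is determined by its special unitary
   elements, so that conjugacy of SU(J) and SU(J') yields conjugacy of gl(J) and
   gl(J'); J is then recovered up to permutation from the minimal central
   projections of gl(J), m_i being the minimal rank of a nonzero element of the
   i-th block, and k_i the same number for the commutant. *)
Require Import Defs.
From mathcomp Require Import all_boot all_order all_fingroup all_algebra.
From mathcomp Require Import generic_quotient character.
From mathcomp Require Import boolp classical_sets functions reals complex.

Set Implicit Arguments.
Unset Strict Implicit.
Unset Printing Implicit Defensive.

Import Order.TTheory GRing.Theory Num.Theory.
Local Open Scope ring_scope.
Local Open Scope sesquilinear_scope.
Local Open Scope quotient_scope.

(** * Conjugate transposes of complex matrices *)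

Section Adjoint.
Variable C : numClosedFieldType.

Lemma adjmxM m n p (A : 'M[C]_(m, n)) (B : 'M[C]_(n, p)) :
  (A *m B) ^t* = B ^t* *m A ^t*.
Proof. by rewrite trmx_mul map_mxM. Qed.

Lemma adjmxD m n (A B : 'M[C]_(m, n)) : (A + B) ^t* = A ^t* + B ^t*.
Proof. by rewrite linearD map_mxD. Qed.

Lemma adjmxB m n (A B : 'M[C]_(m, n)) : (A - B) ^t* = A ^t* - B ^t*.
Proof. by rewrite linearB map_mxB. Qed.

Lemma adjmxZ m n a (A : 'M[C]_(m, n)) : (a *: A) ^t* = a^* *: A ^t*.
Proof. by rewrite linearZ map_mxZ. Qed.

Lemma adjmx_scalar n (a : C) : (a%:M : 'M[C]_n) ^t* = (a^*)%:M.
Proof. by rewrite tr_scalar_mx map_scalar_mx. Qed.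

Lemma adjmx1 n : (1%:M : 'M[C]_n) ^t* = 1%:M.
Proof. by rewrite adjmx_scalar rmorph1. Qed.

Lemma adjmx0 m n : (0 : 'M[C]_(m, n)) ^t* = 0.
Proof. by rewrite trmx0 map_mx0. Qed.

Lemma adjmx_sum m n (I : Type) (r : seq I) (P : pred I) (F : I -> 'M[C]_(m, n)) :
  (\sum_(i <- r | P i) F i) ^t* = \sum_(i <- r | P i) (F i) ^t*.
Proof. by apply: (big_morph (fun A => A ^t*)) => [A B|]; rewrite (adjmxD, adjmx0). Qed.

Lemma adjmx_inj m n (A B : 'M[C]_(m, n)) : A ^t* = B ^t* -> A = B.
Proof. by move=> /(congr1 (fun M => M ^t*)); rewrite !trmxCK. Qed.

Lemma mulmx_adj_diag_ge0 m n (A : 'M[C]_(m, n)) i : 0 <= (A *m A ^t*) i i.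
Proof.
rewrite mxE; apply: sumr_ge0 => j _; rewrite !mxE.
exact: mul_conjC_ge0.
Qed.

(** Each diagonal entry of the product is the sum of the squared moduli along a row of [A], so it
    vanishes only with that row. *)
Lemma mulmx_adj_eq0 m n (A : 'M[C]_(m, n)) : A *m A ^t* = 0 -> A = 0.
Proof.
move=> A0; apply/matrixP => i j; rewrite [RHS]mxE; move/matrixP/(_ i i): A0.
rewrite !mxE => /eqP; rewrite psumr_eq0 => [/allP/(_ j)|k _]; last first.
  by rewrite !mxE mul_conjC_ge0.
by rewrite mem_index_enum !mxE mul_conjC_eq0 => /(_ isT)/eqP.
Qed.

Lemma unitarymx_neq0 m n (A : 'M[C]_(m, n)) : (0 < m)%N -> A *m A ^t* = 1%:M -> A != 0.
Proof.
move=> m0 AA; apply/eqP => A0; move: AA; rewrite A0 mul0mx.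
move=> /matrixP/(_ (Ordinal m0) (Ordinal m0)) /eqP.
by rewrite !mxE eqxx eq_sym oner_eq0.
Qed.

Lemma unitarymx_mulVmx n (U : 'M[C]_n) : U \is unitarymx -> U ^t* *m U = 1%:M.
Proof. by move=> uU; rewrite -invmx_unitary // mulVmx ?unitarymx_unit. Qed.

End Adjoint.

(** * Commutants, and their determination by special unitary elements *)

Section Commutant.
Variables (C : numClosedFieldType) (n : nat).
Implicit Types (S : 'M[C]_n -> Prop) (x y : 'M[C]_n).

Definition commutant S x := forall s, S s -> comm_mx s x.

Definition selfadj S := forall s, S s -> S (s ^t*).

Lemma commutant_adj S x : selfadj S -> commutant S x -> commutant S (x ^t*).
Proof.
by move=> sS cx s /sS/cx; rewrite /comm_mx => /(congr1 (fun A => A ^t*));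
  rewrite !adjmxM trmxCK.
Qed.

Lemma commutantM S x y : commutant S x -> commutant S y -> commutant S (x *m y).
Proof. by move=> cx cy s Ss; apply: comm_mxM; [exact: cx|exact: cy]. Qed.

Lemma commutantD S x y : commutant S x -> commutant S y -> commutant S (x + y).
Proof. by move=> cx cy s Ss; apply: comm_mxD; [exact: cx|exact: cy]. Qed.

Lemma commutantB S x y : commutant S x -> commutant S y -> commutant S (x - y).
Proof. by move=> cx cy s Ss; apply: comm_mxB; [exact: cx|exact: cy]. Qed.

Lemma comm_mxZ x y a : comm_mx x y -> comm_mx x (a *: y).
Proof. by rewrite /comm_mx -scalemxAl -scalemxAr => ->. Qed.

Lemma commutantZ S a x : commutant S x -> commutant S (a *: x).
Proof. by move=> cx s Ss; apply: comm_mxZ; exact: cx. Qed.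

Lemma comm_mx_inv x y : y \in unitmx -> comm_mx x y -> comm_mx x (invmx y).
Proof.
move=> uy xy; apply: (can_inj (mulmxK uy)).
by rewrite mulmxKV // -mulmxA xy mulmxA mulVmx // mul1mx.
Qed.

Lemma commutantV S x : x \in unitmx -> commutant S x -> commutant S (invmx x).
Proof. by move=> ux cx s /cx; exact: comm_mx_inv. Qed.

Lemma commutant_scalar S a : commutant S (a%:M : 'M[C]_n).
Proof. by move=> s _; exact: comm_mx_scalar. Qed.

Lemma det_unitary_norm x : x \is unitarymx -> `|\det x| = 1.
Proof.
move=> /unitarymxP/(congr1 determinant).
rewrite det_mulmx det1 det_map_mx det_tr -normCK => /eqP.
by rewrite sqrp_eq1 // => /eqP.
Qed.

(** The determinant has modulus 1, hence so has an n-th root of its inverse; scaling by that root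
    multiplies the determinant by its n-th power. *)
Lemma unitary_rescale x : (0 < n)%N -> x \is unitarymx ->
  exists2 a : C, `|a| = 1 & (a *: x \is unitarymx) && (\det (a *: x) == 1).
Proof.
move=> n0 ux; pose a := n.-root (\det x)^-1.
have nx := det_unitary_norm ux.
have dx : \det x != 0 by rewrite -normr_gt0 nx.
have an : a ^+ n = (\det x)^-1 by rewrite rootCK.
have na : `|a| = 1.
  have : `|a| ^+ n == 1 by rewrite -normrX an normfV nx invr1.
  by rewrite pexpr_eq1 // => /eqP.
exists a => //.
rewrite detZ an mulVf // eqxx andbT; apply/unitarymxP.
rewrite adjmxZ -scalemxAl -scalemxAr scalerA -normCK na expr1n scale1r.
exact/unitarymxP.
Qed.

(** A hermitian matrix has no eigenvalue -i: on the kernel [Z] one has Z h = -i Z, and comparing the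
    self-adjoint Z h Z^* with its own adjoint forces Z Z^* = 0. *)
Lemma hermitian_addi_unit (h : 'M[C]_n) : h ^t* = h -> h + 'i%:M \in unitmx.
Proof.
move=> hh; rewrite -row_free_unit -kermx_eq0; apply/eqP.
set Z := kermx _; have : Z *m (h + 'i%:M) = 0 by exact: mulmx_ker.
rewrite mulmxDr mul_mx_scalar => /eqP; rewrite addr_eq0 => /eqP; move: Z => Z Zh.
have E1 : Z *m h *m Z ^t* = - ('i *: (Z *m Z ^t*)).
  by rewrite Zh mulNmx -scalemxAl.
have := congr1 (fun A => A ^t*) E1.
rewrite /= !adjmxM trmxCK hh mulmxA E1 -scaleNr adjmxZ adjmxM trmxCK.
rewrite rmorphN /= conjCi opprK => /eqP; rewrite eq_sym -subr_eq0 -scalerBl opprK.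
rewrite -mulr2n scaler_eq0 mulrn_eq0 (negPf (neq0Ci _)) => /eqP; exact: mulmx_adj_eq0.
Qed.

(* The Cayley transform of a hermitian element of the commutant is a unitary
   element of the commutant, which a phase brings to determinant 1. *)
Lemma special_unitary_commutant S x : (0 < n)%N -> selfadj S ->
  (forall u, u \is unitarymx -> \det u = 1 -> commutant S u -> comm_mx x u) ->
  forall y, commutant S y -> comm_mx x y.
Proof.
move=> n0 sS xU.
have xH (h : 'M[C]_n) : h ^t* = h -> commutant S h -> comm_mx x h.
  move=> hh ch; pose c := h + 'i%:M; pose c' := h - 'i%:M.
  have uc : c \in unitmx by exact: hermitian_addi_unit.
  have cc : c ^t* = c' by rewrite adjmxD hh adjmx_scalar conjCi raddfN.
  have cc' : c' ^t* = c by rewrite -cc trmxCK.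
  have uc' : c' \in unitmx by rewrite -cc map_unitmx unitmx_tr.
  have cCc : commutant S c by apply: commutantD => //; exact: commutant_scalar.
  have cCc' : commutant S c' by apply: commutantB => //; exact: commutant_scalar.
  have com : comm_mx c c'.
    apply: comm_mxB; last exact: comm_mx_scalar.
    by apply: comm_mx_sym; apply: comm_mxD; [exact: comm_mx_refl|exact: comm_mx_scalar].
  pose u := c' *m invmx c.
  have uu : u \is unitarymx.
    apply/unitarymxP; rewrite adjmxM cc'.
    rewrite trmx_inv map_invmx cc mulmxA -[c' *m _ *m _]mulmxA.
    rewrite (_ : invmx c *m invmx c' = invmx c' *m invmx c); last first.
      by apply: comm_mx_inv => //; apply/comm_mx_sym/comm_mx_inv/comm_mx_sym.
    by rewrite mulmxA mulmxV // mul1mx mulVmx.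
  have cu : commutant S u by apply: commutantM => //; exact: commutantV.
  have [a na /andP[ua /eqP da]] := unitary_rescale n0 uu.
  have a0 : a != 0 by rewrite -normr_gt0 na.
  have xu : comm_mx x u.
    rewrite -[u]scale1r -(mulVf a0) -scalerA; apply: comm_mxZ.
    by apply: xU => //; exact: commutantZ.
  (* The Cayley transform is affine in the inverse of [c], so commuting with [u] passes to that
     inverse, then to [c], then to [h]. *)
  have uE : u = 1%:M - ('i + 'i) *: invmx c.
    apply: (can_inj (mulmxK uc)); rewrite mulmxKV // mulmxBl mul1mx -scalemxAl.
    rewrite mulVmx // scale_scalar_mx mulr1 raddfD /= /c /c'.
    by rewrite opprD addrA addrK.
  have xV : comm_mx x (invmx c).
    have ii0 : 'i + 'i != 0 :> C by rewrite -mulr2n mulrn_eq0 neq0Ci.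
    rewrite -[invmx c]scale1r -(mulVf ii0) -scalerA; apply: comm_mxZ.
    have <- : 1%:M - u = ('i + 'i) *: invmx c by rewrite uE subKr.
    by apply: comm_mxB => //; exact: comm_mx1.
  have xc : comm_mx x c by rewrite -[c]invmxK; apply: comm_mx_inv; rewrite ?unitmx_inv.
  have hE : h = c - ('i)%:M by rewrite /c addrK.
  by rewrite hE; apply: comm_mxB => //; exact: comm_mx_scalar.
move=> y cy; have cy' := commutant_adj sS cy.
have two0 : 2%:R != 0 :> C by rewrite pnatr_eq0.
(* Decomposition into real and imaginary parts, arranged so that the two matrices fed to [xH] are
   hermitian. *)
have yE : y = 2%:R^-1 *: ((y + y ^t*) - 'i *: ('i *: (y - y ^t*))).
  rewrite scalerA -expr2 sqrCi scaleN1r opprK addrACA subrr addr0.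
  by rewrite -mulr2n -scaler_nat scalerA mulVf // scale1r.
rewrite yE; apply/comm_mxZ/comm_mxB; last (apply/comm_mxZ); apply: xH.
- by rewrite adjmxD trmxCK addrC.
- exact: commutantD.
- by rewrite adjmxZ adjmxB trmxCK conjCi scaleNr -scalerN opprB.
- by apply/commutantZ/commutantB.
Qed.

End Commutant.

(* Totalized indexing: in [e i a b] the indices are natural numbers, and only
   those with i < r, a < k i and b < m i are meaningful. *)
Definition in_range (r : nat) (k m : nat -> nat) i a b :=
  [&& (i < r)%N, (a < k i)%N & (b < m i)%N].

Definition swap (T : Type) (e : nat -> nat -> nat -> T) : nat -> nat -> nat -> T :=
  fun i b a => e i a b.

Lemma in_range_swap r k m i a b : in_range r m k i b a = in_range r k m i a b.
Proof. by congr (_ && _); exact: andbC. Qed.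

(** * Orthonormal frames and the algebras acting on one of their inner indices *)

Section Frames.
Variables (C : numClosedFieldType) (n : nat).
Implicit Types (r : nat) (k m : nat -> nat) (e : nat -> nat -> nat -> 'rV[C]_n).

Definition orthonormal_frame r k m e := forall i a b j c d,
  in_range r k m i a b -> in_range r k m j c d ->
  e i a b *m (e j c d) ^t* = ([&& i == j, a == c & b == d]%:R)%:M.

(** Row vectors are multiplied on the right by operators, so for an orthonormal frame this operator
    takes [e i a b] to [y i a b] and kills the orthogonal complement. With [y := e] it is the
    projection onto the span, whence the completeness condition in [frame]. *)
Definition frame_op p r k m e (y : nat -> nat -> nat -> 'M[C]_(1, p)) : 'M[C]_(n, p) :=
  \sum_(i < r) \sum_(a < k i) \sum_(b < m i) (e i a b) ^t* *m y i a b.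

Lemma mul_frame_op p r k m e y j c d :
  orthonormal_frame r k m e -> in_range r k m j c d ->
  e j c d *m @frame_op p r k m e y = y j c d.
Proof.
move=> on rg; have /and3P[jr ck dm] := rg.
have rgi (i : 'I_r) (a : 'I_(k i)) (b : 'I_(m i)) : in_range r k m i a b.
  by apply/and3P; split.
rewrite mulmx_sumr (bigD1 (Ordinal jr)) //= [X in _ + X]big1 ?addr0 =>
  [|i ij]; last first.
  rewrite mulmx_sumr big1 // => a _; rewrite mulmx_sumr big1 // => b _.
  rewrite mulmxA on // (_ : (j == i) = false) /= ?scalar_mx0 ?mul0mx //.
    by rewrite raddf0 mul0mx.
  by apply/negbTE; apply: contra ij => /eqP ji; apply/eqP/val_inj.
rewrite mulmx_sumr (bigD1 (Ordinal ck)) //= [X in _ + X]big1 ?addr0 =>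
  [|a aj]; last first.
  rewrite mulmx_sumr big1 // => b _.
  rewrite mulmxA on ?(rgi (Ordinal jr)) // eqxx /= (_ : (c == a) = false) /=.
    by rewrite raddf0 mul0mx.
  by apply/negbTE; apply: contra aj => /eqP ji; apply/eqP/val_inj.
rewrite mulmx_sumr (bigD1 (Ordinal dm)) //= [X in _ + X]big1 ?addr0 =>
  [|b bj]; last first.
  rewrite mulmxA on ?(rgi (Ordinal jr) (Ordinal ck)) // !eqxx /=.
  rewrite (_ : (d == b) = false) /=.
    by rewrite raddf0 mul0mx.
  by apply/negbTE; apply: contra bj => /eqP ji; apply/eqP/val_inj.
by rewrite mulmxA on // !eqxx /= mul1mx.
Qed.

Definition frame r k m e := orthonormal_frame r k m e /\ frame_op r k m e e = 1%:M.

Lemma frame_eq p r k m e (x y : 'M[C]_(n, p)) : frame r k m e ->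
  (forall i a b, in_range r k m i a b -> e i a b *m x = e i a b *m y) -> x = y.
Proof.
move=> [_ e1] xy; rewrite -[x]mul1mx -[y]mul1mx -e1 /frame_op !mulmx_suml.
apply: eq_bigr => i _; rewrite !mulmx_suml; apply: eq_bigr => a _.
rewrite !mulmx_suml; apply: eq_bigr => b _.
by rewrite -!mulmxA xy //; apply/and3P.
Qed.

Lemma frame_eq2 r k m e (x y : 'M[C]_n) : frame r k m e ->
  (forall i a b j c d, in_range r k m i a b -> in_range r k m j c d ->
    e i a b *m x *m (e j c d) ^t* = e i a b *m y *m (e j c d) ^t*) -> x = y.
Proof.
move=> fe xy; apply: (frame_eq fe) => i a b rg; apply: adjmx_inj.
apply: (frame_eq fe) => j c d rg'; apply: adjmx_inj.
by rewrite !adjmxM !trmxCK xy.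
Qed.

Lemma frame_swap r k m e : frame r k m e -> frame r m k (swap e).
Proof.
move=> [on e1]; split=> [i b a j d c|].
  rewrite !(in_range_swap r k m) => /on ei /ei ->; congr (_%:R%:M).
  by rewrite [(a == c) && _]andbC.
by rewrite -e1; apply: eq_bigr => i _; rewrite exchange_big.
Qed.

(* For the standard frame of J this is gl(J, C); exchanging the indices a and b
   ([swap]) gives its commutant. *)
Definition gl r k m e (x : 'M[C]_n) := exists D : nat -> nat -> nat -> C,
  forall i a b, in_range r k m i a b ->
  e i a b *m x = \sum_(a' < k i) D i a a' *: e i a' b.

(** Inside each block the two matrices act on different indices, so the order of the two summations
    is immaterial. *)
Lemma comm_gl r k m e x y : frame r k m e ->
  gl r k m e x -> gl r m k (swap e) y -> comm_mx x y.
Proof.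
move=> fe [D xD] [F yF]; apply: (frame_eq fe) => i a b /and3P[ir ak bm].
have xE b' : (b' < m i)%N -> e i a b' *m x = \sum_(a' < k i) D i a a' *: e i a' b'.
  by move=> b'm; apply: xD; apply/and3P.
have yE a' : (a' < k i)%N -> e i a' b *m y = \sum_(b' < m i) F i b b' *: e i a' b'.
  by move=> a'k; apply: (yF i b a'); apply/and3P.
rewrite !mulmxA xE // yE // !mulmx_suml.
under eq_bigr => a' _ do rewrite -scalemxAl yE // scaler_sumr.
rewrite exchange_big /=; apply: eq_bigr => b' _.
rewrite -scalemxAl xE // scaler_sumr.
by apply: eq_bigr => a' _; rewrite !scalerA mulrC.
Qed.

(** The matrix unit of block [i] in the index b: it moves [b] to [b'] simultaneously for all a. *)
Definition frame_unit r k m e i b b' :=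
  frame_op r k m e (fun j c d => if (j == i) && (d == b) then e j c b' else 0).

Lemma frame_unit_gl r k m e i b b' : orthonormal_frame r k m e -> (b' < m i)%N ->
  gl r m k (swap e) (frame_unit r k m e i b b').
Proof.
move=> on b'm; exists (fun j d d' => [&& j == i, d == b & d' == b']%:R) => j d c.
rewrite in_range_swap => rg; rewrite [LHS](mul_frame_op _ on rg).
case: (eqVneq j i) => [->|_] /=; last by rewrite big1 // => ? _; rewrite scale0r.
case: (eqVneq d b) => [_|_] /=; last by rewrite big1 // => ? _; rewrite scale0r.
rewrite (bigD1 (Ordinal b'm)) //= eqxx scale1r big1 ?addr0 // => d' d'b.
by rewrite (_ : (d' == b' :> nat) = false) ?scale0r //; apply/negbTE.
Qed.

(** Each [e i a b] is obtained from [e i a 0] by a matrix unit commuting with [x]. Applying [x]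
    first and the matrix unit afterwards keeps only the components of [e i a 0 *m x] in block [i]
    with b = 0, and sends these to index [b]; the coefficients are therefore independent of [b]. *)
Lemma commutant_unit_gl r k m e x : frame r k m e ->
  (forall i b, (i < r)%N -> (b < m i)%N -> comm_mx (frame_unit r k m e i 0 b) x) ->
  gl r k m e x.
Proof.
move=> [on e1] xF.
exists (fun i a a' => (e i a 0 *m x *m (e i a' 0) ^t*) 0 0) => i a b rg.
have /and3P[ir ak bm] := rg.
have rg0 : in_range r k m i a 0 by apply/and3P; split=> //; apply: leq_ltn_trans bm.
have {1}-> : e i a b = e i a 0 *m frame_unit r k m e i 0 b.
  by rewrite mul_frame_op // !eqxx.
rewrite -mulmxA xF // mulmxA mulmx_sumr (bigD1 (Ordinal ir)) //= [X in _ + X]big1 ?addr0.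
  rewrite mulmx_sumr; apply: eq_bigr => a' _.
  rewrite mulmx_sumr (bigD1 (Ordinal (leq_ltn_trans (leq0n b) bm))) //= big1 ?addr0.
    by rewrite !eqxx /= mulmxA [X in X *m _]mx11_scalar mul_scalar_mx.
  by move=> d d0; rewrite eqxx /= ifN ?mulmx0.
move=> j ji; rewrite mulmx_sumr big1 // => c _; rewrite mulmx_sumr big1 // => d _.
by rewrite ifN ?mulmx0 // negb_and; apply/orP; left.
Qed.

(** One direction is [comm_gl], the other tests [x] on matrix units only. Applied also to the
    swapped frame, this shows that the two algebras are each other's commutants. *)
Lemma gl_commutant r k m e x : frame r k m e ->
  gl r k m e x <-> commutant (gl r m k (swap e)) x.
Proof.
move=> fe; split=> [gx y gy|cx]; first exact/comm_mx_sym/(comm_gl fe).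
by apply: commutant_unit_gl => // i b ir bm; apply/cx/frame_unit_gl => //; case: fe.
Qed.

Lemma gl_selfadj r k m e : frame r k m e -> selfadj (gl r k m e).
Proof.
move=> fe x [D xD]; have on := fe.1; have os := (frame_swap fe).1.
exists (fun i a a' => (D i a' a)^*) => i a b rg.
apply: adjmx_inj; apply: (frame_eq fe) => j c d rg'.
have /and3P[ir ak bm] := rg; have /and3P[jr ck dm] := rg'.
rewrite adjmxM trmxCK mulmxA xD // mulmx_suml adjmx_sum mulmx_sumr.
under eq_bigr => c' _.
  rewrite -scalemxAl on //; last exact/and3P.
  over.
under [RHS]eq_bigr => a' _.
  rewrite adjmxZ conjCK -scalemxAr on //; last exact/and3P.
  over.
have [ji|ji] := eqVneq j i; last first.
  by rewrite !big1 // => ? _; rewrite raddf0 scaler0.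
subst j; rewrite (bigD1 (Ordinal ak)) //= [X in _ + X = _]big1 ?addr0 => [|a' ac].
  rewrite [RHS](bigD1 (Ordinal ck)) //= [X in _ = _ + X]big1 ?addr0 ?eqxx // => a' ac.
  by rewrite (_ : (c == a') = false) ?andbF ?raddf0 ?scaler0 // eq_sym; apply/negbTE.
by rewrite (_ : (a' == a :> nat) = false) ?andbF ?raddf0 ?scaler0 //; apply/negbTE.
Qed.

(** The operator taking one frame to the other is unitary, since both frames have the same Gram
    matrix and are complete. *)
Lemma frame_change r k m e e' : frame r k m e -> frame r k m e' ->
  exists2 U : 'M[C]_n, U \is unitarymx &
    forall i a b, in_range r k m i a b -> e' i a b = e i a b *m U.
Proof.
move=> fe fe'; exists (frame_op r k m e e') => [|i a b rg]; last first.
  by rewrite mul_frame_op //; case: fe.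
apply/unitarymxP; apply: (frame_eq2 fe) => i a b j c d rg rg'.
rewrite mulmx1 mulmxA (mul_frame_op _ fe.1 rg) -mulmxA -adjmxM.
by rewrite (mul_frame_op _ fe.1 rg') fe.1 // fe'.1.
Qed.

Lemma gl_conj r k m e e' (U x : 'M[C]_n) : U \is unitarymx ->
  (forall i a b, in_range r k m i a b -> e' i a b = e i a b *m U) ->
  gl r k m e' x <-> gl r k m e (U *m x *m U ^t*).
Proof.
move=> uU ee'.
have UU : U *m U ^t* = 1%:M by exact/unitarymxP.
have UU' := unitarymx_mulVmx uU.
split=> -[D xD]; exists D => i a b rg; have /and3P[ir ak bm] := rg.
  rewrite !mulmxA -ee' // xD // mulmx_suml; apply: eq_bigr => a' _.
  by rewrite ee' -?scalemxAl -?mulmxA ?UU ?mulmx1 //; apply/and3P.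
rewrite ee' // -[x]mulmx1 -UU' (mulmxA x) -(mulmxA (e i a b)) !(mulmxA U) mulmxA xD //.
by rewrite mulmx_suml; apply: eq_bigr => a' _; rewrite ee' -?scalemxAl //; apply/and3P.
Qed.

Lemma frame_unitary r k m e (U : 'M[C]_n) : U \is unitarymx -> frame r k m e ->
  frame r k m (fun i a b => e i a b *m U).
Proof.
move=> uU [on e1]; split=> [i a b j c d rg rg'|].
  by rewrite adjmxM mulmxA -(mulmxA _ U) (unitarymxP _) // mulmx1 on.
transitivity (U ^t* *m (1%:M *m U)); last by rewrite mul1mx unitarymx_mulVmx.
rewrite -e1 mulmx_suml mulmx_sumr.
apply: eq_bigr => i _; rewrite mulmx_suml mulmx_sumr.
apply: eq_bigr => a _; rewrite mulmx_suml mulmx_sumr.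
by apply: eq_bigr => b _; rewrite adjmxM !mulmxA.
Qed.

(** The trace of the resolution of the identity: every rank-one summand has trace 1. *)
Lemma frame_dim r k m e : frame r k m e -> (\sum_(i < r) k i * m i)%N = n.
Proof.
move=> [on /(congr1 mxtrace)]; rewrite mxtrace1 raddf_sum /= => E.
apply/eqP; rewrite -(eqr_nat C) -E natr_sum; apply/eqP/eq_bigr => i _.
transitivity (\sum_(a < k i) (m i)%:R : C).
  by rewrite sumr_const card_ord -mulrnA mulnC.
rewrite raddf_sum; apply: eq_bigr => a _ /=.
transitivity (\sum_(b < m i) 1 : C); first by rewrite sumr_const card_ord.
rewrite raddf_sum; apply: eq_bigr => b _ /=.
by rewrite mxtrace_mulC on ?eqxx ?mxtrace1 //; apply/and3P.
Qed.

End Frames.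

(** * Decomposition of C^n under a self-adjoint set of matrices *)

Section Structure.
Variables (C : numClosedFieldType) (n : nat) (S : 'M[C]_n -> Prop).
Hypothesis sS : selfadj S.
Implicit Types (P : 'M[C]_n).

Definition invariant_proj P := [/\ P ^t* = P, P *m P = P & commutant S P].

(** The rows of [T] are an orthonormal basis of an invariant subspace on which [s] acts by T s T^*.
    Irreducibility is encoded by the conclusion of Schur's lemma, the only form in which it is
    used. *)
Definition irreducible m (T : 'M[C]_(m, n)) :=
  [/\ (0 < m)%N, T *m T ^t* = 1%:M,
      forall s, S s -> T *m s = T *m s *m T ^t* *m T &
      forall X : 'M_m, (forall s, S s -> comm_mx X (T *m s *m T ^t*)) ->
        exists a, X = a%:M].

(** Equal ranks would put the rows of [T], which lie in the range of [P], into the range of [Q],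
    where [Q] acts as the identity, against T Q = 0. This drives the inductions on the rank. *)
Lemma mxrank_proj_lt p (T : 'M[C]_(p, n)) P Q :
  Q *m Q = Q -> Q = Q *m P -> T *m P = T -> T *m Q = 0 -> T != 0 ->
  (\rank Q < \rank P)%N.
Proof.
move=> QQ QP TP TQ T0; have sQP : (Q <= P)%MS by rewrite QP submxMl.
rewrite ltn_neqAle mxrankS // andbT; apply: contra T0 => /eqP rQP.
have /andP[_ sPQ] : (Q == P)%MS by rewrite -(mxrank_leqif_eq sQP) rQP.
have : (T <= Q)%MS by apply: submx_trans sPQ; rewrite -TP submxMl.
by case/submxP => Y TY; rewrite -TQ {1}TY -{1}QQ mulmxA -TY.
Qed.

(** Gram-Schmidt is applied to a nonzero invariant subspace of minimal rank inside the range of [P].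
    For [X] commuting with the action, an eigenspace of [X] is invariant, hence everything by
    minimality, so [X] is scalar. *)
Lemma exists_irreducible P : invariant_proj P -> P != 0 ->
  exists m (T : 'M[C]_(m, n)), irreducible T /\ T *m P = T.
Proof.
move=> [_ PP cP] P0.
suff [V [V0 VP Vs Vmin]] : exists V : 'M[C]_n, [/\ V != 0, (V <= P)%MS,
    (forall s, S s -> (V *m s <= V)%MS) & forall p (W : 'M[C]_(p, n)), W != 0 ->
    (W <= V)%MS -> (forall s, S s -> (W *m s <= W)%MS) -> (\rank V <= \rank W)%N].
  pose T := schmidt (row_base V).
  have rn : (\rank V <= n)%N by exact: rank_leq_col.
  have TT : T *m T ^t* = 1%:M by apply/unitarymxP/schmidt_unitarymx.
  have TV : (T :=: V)%MS.
    by apply: eqmx_trans (eq_row_base V); apply: eqmx_schmidt_free; exact: row_base_free.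
  have TP : T *m P = T.
    have : (T <= P)%MS by rewrite TV.
    by case/submxP => Y ->; rewrite -mulmxA PP.
  have Ts s : S s -> T *m s = T *m s *m T ^t* *m T.
    move=> Ss; have : (T *m s <= T)%MS.
      by rewrite (eqmxMr s TV) TV; exact: Vs.
    by case/submxP => Y ->; rewrite -[Y *m T *m _]mulmxA TT mulmx1.
  have m0 : (0 < \rank V)%N by rewrite lt0n mxrank_eq0.
  exists (\rank V), T; split=> //; split=> // X cX.
  have [a /eigenvalueP[v vX v0]] := eigenvalue_closed X m0.
  exists a; set Z := kermx (X - a%:M).
  have vZ : (v <= Z)%MS.
    by apply/sub_kermxP; rewrite mulmxBr vX mul_mx_scalar subrr.
  have ZX : Z *m (X - a%:M) = 0 by exact: mulmx_ker.
  have Zr s : S s -> (Z *m (T *m s *m T ^t*) <= Z)%MS.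
    move=> Ss; apply/sub_kermxP.
    have -> : Z *m (T *m s *m T ^t*) *m (X - a%:M) =
              Z *m ((X - a%:M) *m (T *m s *m T ^t*)).
      rewrite -mulmxA; congr (Z *m _); apply: comm_mxB; last exact: comm_mx_scalar.
      exact/comm_mx_sym/cX.
    by rewrite [LHS]mulmxA ZX mul0mx.
  have rZT : \rank (Z *m T) = \rank Z.
    by rewrite mxrankMfree // /row_free mxrank_unitary //; apply/unitarymxP.
  have rZ : (\rank V <= \rank Z)%N.
    rewrite -rZT; apply: Vmin.
    - rewrite -mxrank_eq0 rZT mxrank_eq0; apply: contra v0 => /eqP Z0.
      by move: vZ; rewrite Z0 submx0.
    - by rewrite -TV submxMl.
    - move=> s Ss; rewrite -mulmxA Ts // mulmxA; apply: submxMr; exact: Zr.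
  have Zu : Z \in unitmx by rewrite -row_free_unit /row_free eqn_leq rank_leq_row.
  by apply/eqP; rewrite -subr_eq0 -[X - _](mulKmx Zu) ZX mulmx0.
(* A minimal subspace is reached by descent: as long as a nonzero invariant subspace of smaller rank
   exists, it replaces [V]. *)
suff H d (V : 'M[C]_n) : (\rank V <= d)%N -> V != 0 -> (V <= P)%MS ->
    (forall s, S s -> (V *m s <= V)%MS) -> exists V' : 'M[C]_n, [/\ V' != 0, (V' <= P)%MS,
    (forall s, S s -> (V' *m s <= V')%MS) & forall p (W : 'M[C]_(p, n)), W != 0 ->
    (W <= V')%MS -> (forall s, S s -> (W *m s <= W)%MS) -> (\rank V' <= \rank W)%N].
  by apply: (H n P) => //; [exact: rank_leq_col|move=> s Ss; rewrite -cP // submxMl].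
elim: d V => [|d IH] V rV V0 VP Vs.
  by move: V0; rewrite -mxrank_eq0 -leqn0 rV.
have [[p [W [W0 WV Ws rW]]]|noW] := pselect (exists p (W : 'M[C]_(p, n)), [/\ W != 0,
  (W <= V)%MS, (forall s, S s -> (W *m s <= W)%MS) & (\rank W < \rank V)%N]).
  apply: (IH <<W>>%MS).
  - by rewrite genmxE -ltnS (leq_trans rW).
  - by rewrite -mxrank_eq0 genmxE mxrank_eq0.
  - by rewrite genmxE (submx_trans WV).
  - by move=> s Ss; rewrite genmxE (eqmxMr s (genmxE W)) Ws.
exists V; split=> // p W W0 WV Ws; rewrite leqNgt; apply/negP => rW.
by apply: noW; exists p, W.
Qed.

(** Such an [X] is a module homomorphism into C^n from the space carrying the action of S through
    [T]. *)
Definition intertwines m (T X : 'M[C]_(m, n)) :=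
  forall s, S s -> X *m s = T *m s *m T ^t* *m X.

Lemma intertwines_adj m (T X : 'M[C]_(m, n)) s : intertwines T X -> S s ->
  s *m X ^t* = X ^t* *m (T *m s *m T ^t*).
Proof.
by move=> TX Ss; apply: adjmx_inj; rewrite !adjmxM !trmxCK TX ?mulmxA //; exact: sS.
Qed.

Lemma intertwines_commutant m (T X : 'M[C]_(m, n)) x :
  intertwines T X -> commutant S x -> intertwines T (X *m x).
Proof. by move=> TX cx s Ss; rewrite -mulmxA -cx // !mulmxA TX // !mulmxA. Qed.

(** As S is self-adjoint, the adjoint of [Y] intertwines in the opposite direction, so X Y^*
    commutes with the action and Schur's lemma applies. *)
Lemma intertwines_scalar m (T X Y : 'M[C]_(m, n)) : irreducible T ->
  intertwines T X -> intertwines T Y -> exists a, X *m Y ^t* = a%:M.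
Proof.
move=> [_ _ _ schur] TX TY; apply: schur => s Ss.
by rewrite /comm_mx -mulmxA -intertwines_adj // !mulmxA TX.
Qed.

(** Mutually orthogonal copies of the irreducible are split off one at a time, with the rank of the
    remaining projection dropping, until no nonzero intertwiner into it is left; [k] is the
    multiplicity. *)
Lemma isotypic_split m (T0 : 'M[C]_(m, n)) P : irreducible T0 -> invariant_proj P ->
  exists k (T : nat -> 'M[C]_(m, n)), let P' := P - \sum_(a < k) (T a) ^t* *m T a in
  [/\ forall a c, (a < k)%N -> (c < k)%N -> T a *m (T c) ^t* = ((a == c)%:R)%:M,
      forall a, (a < k)%N -> intertwines T0 (T a),
      forall a, (a < k)%N -> T a *m P = T a,
      invariant_proj P' &
      forall X, intertwines T0 X -> X *m P' = 0].
Proof.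
move=> irrT0; have [m0 T00 _ _] := irrT0; have [d] := ubnP (\rank P).
elim: d P => // d IH P rP [Ph PP cP].
have [noX|] := pselect (forall X, intertwines T0 X -> X *m P = 0).
  by exists 0%N, (fun _ => 0) => /=; rewrite big_ord0 subr0; split.
move=> /existsNP[X /not_implyP[TX /eqP XP0]].
have TY : intertwines T0 (X *m P) by exact: intertwines_commutant.
have YP : X *m P *m P = X *m P by rewrite -mulmxA PP.
move: (X *m P) XP0 TY YP => Y Y0 TY YP {TX X}.
have [l YY] := intertwines_scalar irrT0 TY TY.
have l0 : 0 < l.
  rewrite lt0r; apply/andP; split.
    by apply: contra Y0 => /eqP l0; apply/eqP/mulmx_adj_eq0; rewrite YY l0 raddf0.
  by have := mulmx_adj_diag_ge0 Y (Ordinal m0); rewrite YY mxE eqxx.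
(* By Schur's lemma Y Y^* is a scalar [l] > 0, so this rescaling makes the rows of [Y]
   orthonormal. *)
pose c := (sqrtC l)^-1; pose T := c *: Y.
have cc : c^* = c by rewrite geC0_conj // invr_ge0 sqrtC_ge0 ltW.
have TT : T *m T ^t* = 1%:M.
  rewrite adjmxZ -scalemxAl -scalemxAr scalerA YY scale_scalar_mx cc -expr2.
  by rewrite exprVn sqrtCK mulVf // gt_eqF.
have TP : T *m P = T by rewrite -scalemxAl YP.
have iT : intertwines T0 T.
  by move=> s Ss; rewrite -scalemxAl TY // -scalemxAr.
have PT : P *m T ^t* = T ^t* by apply: adjmx_inj; rewrite adjmxM trmxCK Ph.
pose P1 := P - T ^t* *m T.
have TP1 : T *m P1 = 0 by rewrite mulmxBr TP mulmxA TT mul1mx subrr.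
have P1P : P1 *m P = P1 by rewrite mulmxBl PP -mulmxA TP.
have P11 : P1 *m P1 = P1.
  rewrite {2}/P1 mulmxBr P1P mulmxA mulmxBl PT -[T ^t* *m T *m _]mulmxA TT.
  by rewrite mulmx1 subrr mul0mx subr0.
have P1h : P1 ^t* = P1 by rewrite adjmxB Ph adjmxM trmxCK.
have cP1 : commutant S P1.
  apply: commutantB => // s Ss.
  by rewrite /comm_mx mulmxA (intertwines_adj iT) // -[RHS]mulmxA iT // -[LHS]mulmxA.
have Tn0 : T != 0 by exact: unitarymx_neq0.
have rP1 : (\rank P1 < d)%N.
  by rewrite -ltnS (leq_trans _ rP) // ltnS; apply: (mxrank_proj_lt P11 _ TP TP1).
have [//|k [T' [onT iT' T'P1 invP' noX]]] := IH P1 rP1.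
have T'T a : (a < k)%N -> T' a *m T ^t* = 0.
  by move=> ak; rewrite -T'P1 // -mulmxA -P1h -adjmxM TP1 adjmx0 mulmx0.
exists k.+1, (fun a => if a is a'.+1 then T' a' else T).
rewrite /= big_ord_recl /= opprD addrA; split=> //.
- move=> [|a] [|a'] //= ak a'k; last exact: onT.
    by apply: adjmx_inj; rewrite adjmxM trmxCK T'T // raddf0 adjmx0.
  by rewrite T'T // raddf0.
- by case=> [|a] // ak; exact: iT'.
- by case=> [|a] // ak; rewrite -T'P1 // -mulmxA P1P.
Qed.

(** A standard basis vector indexed by a natural number, to match the totalized indexing of frames;
    it is zero when [b] is at least [m]. *)
Definition unit_row m b : 'rV[C]_m := \row_j (j == b :> nat)%:R.

Lemma unit_rowE m (b : 'I_m) : unit_row m b = delta_mx 0 b.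
Proof. by apply/rowP => j; rewrite !mxE eqxx. Qed.

Lemma mul_row_unit m (v : 'rV[C]_m) (b : 'I_m) : v *m (unit_row m b) ^t* = (v 0 b)%:M.
Proof.
apply/matrixP => i j; rewrite !ord1 !mxE (bigD1 b) //= !mxE eqxx rmorph1 mulr1.
rewrite big1 ?addr0 // => c cb.
by rewrite !mxE [(c : nat) == b](negbTE cb) rmorph0 mulr0.
Qed.

Lemma unit_row_dot m b d : (d < m)%N ->
  unit_row m b *m (unit_row m d) ^t* = ((b == d)%:R)%:M.
Proof. by move=> dm; rewrite (mul_row_unit _ (Ordinal dm)) mxE eq_sym. Qed.

Lemma row_expand m (v : 'rV[C]_m) :
  v = \sum_(b < m) (v *m (unit_row m b) ^t*) 0 0 *: unit_row m b.
Proof.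
rewrite {1}[v]row_sum_delta; apply: eq_bigr => b _.
by rewrite mul_row_unit mxE eqxx unit_rowE.
Qed.

Lemma sum_unit_row m : \sum_(b < m) (unit_row m b) ^t* *m unit_row m b = 1%:M.
Proof.
rewrite mx1_sum_delta; apply: eq_bigr => b _.
apply/matrixP => i j; rewrite !mxE big_ord1 !mxE rmorph_nat -natrM mulnb.
by rewrite !val_eqE.
Qed.

(** Induction on the rank of [P]: the isotypic component of one irreducible [T0] becomes block 0,
    and the remaining projection supplies the later blocks. All copies carry the same matrices T0 s
    T0^*, so [s] acts on b alone; Schur's lemma makes the commutant act on a alone. *)
Lemma structure P : invariant_proj P -> exists r k m (e : nat -> nat -> nat -> 'rV[C]_n),
  [/\ forall i, (i < r)%N -> (0 < k i)%N && (0 < m i)%N,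
      orthonormal_frame r k m e, frame_op r k m e e = P,
      forall s, S s -> gl r m k (swap e) s &
      forall x, commutant S x -> gl r k m e (x *m P)].
Proof.
have [d] := ubnP (\rank P); elim: d P => // d IH P rP invP.
have [P0|P0] := eqVneq P 0.
  exists 0%N, (fun _ => 0%N), (fun _ => 0%N), (fun _ _ _ => 0); split=> //.
  - by rewrite /frame_op big_ord0.
  - by move=> s _; exists (fun _ _ _ => 0).
  - by move=> s _; exists (fun _ _ _ => 0).
have [m0 [T0 [irrT0 T0P]]] := exists_irreducible invP P0.
have [m0_gt0 T00 T0s _] := irrT0.
have [k0 [T [onT iT TP invP' noX]]] := isotypic_split irrT0 invP.
move EP' : (P - _) invP' noX => P' invP' noX.
have PE : P = \sum_(a < k0) (T a) ^t* *m T a + P' by rewrite -EP' addrC subrK.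
have [Ph PP cP] := invP; have [P'h P'P' cP'] := invP'.
(* [T0] is itself a nonzero intertwiner into the range of [P], so at least one copy is split off. *)
have k0_gt0 : (0 < k0)%N.
  rewrite lt0n; apply/eqP => k00.
  have : T0 *m P = 0.
    by rewrite PE k00 big_ord0 add0r; apply: noX => s Ss; rewrite -T0s.
  by apply/eqP; rewrite T0P unitarymx_neq0.
have TP' a : (a < k0)%N -> T a *m P' = 0 by move=> ak; apply: noX; exact: iT.
have P'P : P' *m P = P'.
  rewrite -EP' mulmxBl PP mulmx_suml; congr (_ - _); apply: eq_bigr => a _.
  by rewrite -mulmxA TP.
have T_neq0 : T 0%N != 0 by apply: unitarymx_neq0; rewrite ?onT.
have rP' : (\rank P' < d)%N.
  rewrite -ltnS (leq_trans _ rP) // ltnS.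
  by apply: (mxrank_proj_lt P'P' _ (TP _ k0_gt0) (TP' _ k0_gt0)).
have [r [k [m [e [pos on eP' Se xe]]]]] := IH P' rP' invP'.
have eE i a b : in_range r k m i a b -> e i a b *m P' = e i a b.
  by move=> rg; rewrite -eP' mul_frame_op.
have Te a i c b : (a < k0)%N -> in_range r k m i c b -> T a *m (e i c b) ^t* = 0.
  by move=> ak rg; rewrite -eE // adjmxM P'h mulmxA TP' // mul0mx.
pose k' i := if i is i'.+1 then k i' else k0.
pose m' i := if i is i'.+1 then m i' else m0.
(* In the new block, [e' 0 a b] is the [b]-th row of the copy [T a]. *)
pose e' i a b := if i is i'.+1 then e i' a b else unit_row m0 b *m T a.
exists r.+1, k', m', e'; split.
- by case=> [|i] ir; [rewrite k0_gt0|exact: pos].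
- move=> [|i] a b [|j] c d' /= rg rg'.
  + have /and3P[_ ak bm] := rg; have /and3P[_ ck dm] := rg'.
    rewrite adjmxM mulmxA -[_ *m T a *m _]mulmxA onT // mul_mx_scalar -scalemxAl.
    by rewrite unit_row_dot // scale_scalar_mx -natrM mulnb.
  + by have /and3P[_ ak bm] := rg; rewrite -mulmxA Te // mulmx0 raddf0.
  + have /and3P[_ ck dm] := rg'.
    by apply: adjmx_inj; rewrite adjmxM trmxCK -mulmxA Te // mulmx0 raddf0 adjmx0.
  + exact: on.
- rewrite /frame_op big_ord_recl -[X in _ + X]/(frame_op r k m e e) eP' /=.
  rewrite PE; congr (_ + _); apply: eq_bigr => a _.
  transitivity ((T a) ^t* *m (1%:M *m T a)); last by rewrite mul1mx.
  rewrite -sum_unit_row mulmx_suml mulmx_sumr.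
  by apply: eq_bigr => b _; rewrite adjmxM !mulmxA.
- move=> s Ss; have [F sF] := Se s Ss.
  exists (fun i b b' => if i is i'.+1 then F i' b b' else
    (unit_row m0 b *m (T0 *m s *m T0 ^t*) *m (unit_row m0 b') ^t*) 0 0).
  move=> [|i] b a rg /=; last exact: sF.
  have /and3P[_ bm ak] := rg.
  rewrite /swap /= -mulmxA iT // mulmxA [X in X *m _]row_expand mulmx_suml.
  by apply: eq_bigr => b' _; rewrite -scalemxAl.
- move=> x cx; have [D xD] := xe x cx.
  have cx' := commutant_adj sS cx.
  (* The commutant does not mix the isotypic component with the rest: on adjoints, [T a] followed by
     x^* is again an intertwiner, and [P'] kills it. *)
  have xT a : (a < k0)%N -> P' *m x *m (T a) ^t* = 0.
    move=> ak; apply: adjmx_inj; rewrite !adjmxM trmxCK P'h mulmxA adjmx0.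
    by apply: noX; apply: intertwines_commutant => //; exact: iT.
  (* The product of [T a], [x] and the adjoint of [T a'] is a scalar matrix, so its value is read
     off at coordinate 0. *)
  exists (fun i a a' => if i is i'.+1 then D i' a a' else
    (unit_row m0 0 *m (T a *m x *m (T a') ^t*) *m (unit_row m0 0) ^t*) 0 0).
  move=> [|i] a b rg /=; have /and3P[ir ak bm] := rg.
    have iTx : intertwines T0 (T a *m x) by apply: intertwines_commutant => //; exact: iT.
    rewrite mulmxA -[_ *m T a *m x]mulmxA -mulmxA PE mulmxDr noX // addr0.
    rewrite mulmx_sumr mulmx_sumr.
    apply: eq_bigr => c _.
    transitivity (unit_row m0 b *m (T a *m x *m (T c) ^t*) *m T c).
      by rewrite !mulmxA.
    have [l ->] := intertwines_scalar irrT0 iTx (iT c (ltn_ord c)).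
    rewrite !mul_mx_scalar -!scalemxAl unit_row_dot // eqxx.
    by rewrite !mxE eqxx mulr1.
  rewrite PE mulmxDr mulmxDr xD // mulmx_sumr mulmx_sumr big1 ?add0r // => c _.
  by rewrite !mulmxA -eE // -(mulmxA (e i a b)) -(mulmxA (e i a b)) xT // mulmx0 mul0mx.
Qed.

End Structure.

(** * Entries of Kronecker products *)

Section KroneckerEntries.
Variable F : fieldType.

Lemma trow_entry n1 m2 n2 (A : 'rV[F]_n1) (B : 'M[F]_(m2, n2)) i (c : 'I_n1)
    (d : 'I_n2) (y : 'I_(n1 * n2)) :
  y = (c * n2 + d)%N :> nat -> trow A B i y = A 0 c * B i d.
Proof.
elim: n1 A c y => [A []//|n1 IH] A [[|c] cn] y /= yE; rewrite mxE; case: splitP => y' y'E.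
- rewrite !mxE; congr (A 0 _ * B i _); apply/val_inj => //=.
  by rewrite -y'E yE.
- by move: (ltn_ord d); rewrite -[(d < n2)%N]/(0 * n2 + d < n2)%N -yE y'E ltnNge leq_addr.
- by move: (ltn_ord y'); rewrite -y'E yE mulSn -addnA ltnNge leq_addr.
- rewrite (IH _ (Ordinal (cn : c < n1)%N)).
    by rewrite mxE; congr (A 0 _ * _); apply/val_inj.
  by apply/eqP; rewrite -(eqn_add2l n2) -y'E yE mulSn addnA.
Qed.

Lemma tprod_entry m1 n1 m2 n2 (A : 'M[F]_(m1, n1)) (B : 'M[F]_(m2, n2))
    (a : 'I_m1) (b : 'I_m2) (c : 'I_n1) (d : 'I_n2)
    (x : 'I_(m1 * m2)) (y : 'I_(n1 * n2)) :
  x = (a * m2 + b)%N :> nat -> y = (c * n2 + d)%N :> nat ->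
  tprod A B x y = A a c * B b d.
Proof.
elim: m1 A a x => [A []//|m1 IH] A [[|a] am] x /= xE yE;
  rewrite mxE; case: splitP => x' x'E.
- rewrite (trow_entry _ _ _ yE) !mxE; congr (A _ _ * B _ _); apply/val_inj => //=.
  by rewrite -x'E xE.
- by move: (ltn_ord b); rewrite -[(b < m2)%N]/(0 * m2 + b < m2)%N -xE x'E ltnNge leq_addr.
- by move: (ltn_ord x'); rewrite -x'E xE mulSn -addnA ltnNge leq_addr.
- rewrite (IH _ (Ordinal (am : a < m1)%N)) //.
    by rewrite mxE; congr (A _ _ * _); apply/val_inj.
  by apply/eqP; rewrite -(eqn_add2l m2) -x'E xE mulSn addnA.
Qed.

End KroneckerEntries.

(** * The standard frame of J and its identification with gl(J, C) *)

Section StandardFrame.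
Variables (R : realType) (n : nat) (J : K n).
Local Notation C := R[i].
Local Notation r := (K_len J).
Local Notation k := (nth 0%N (K_val J).1).
Local Notation m := (nth 0%N (K_val J).2).

Lemma block_pos_lt (i : 'I_r) (a : 'I_(K_k i)) (b : 'I_(K_m i)) :
  (a * K_m i + b < K_k i * K_m i)%N.
Proof.
apply: (@leq_trans (a.+1 * K_m i)); last by rewrite leq_mul2r ltn_ord orbT.
by rewrite mulSn addnC ltn_add2r.
Qed.

Definition std_ord (i : 'I_r) (a : 'I_(K_k i)) (b : 'I_(K_m i)) : 'I_n :=
  cast_ord (K_sum J) (tagnat.Rank i (Ordinal (block_pos_lt a b))).

(** The position [std_ord] as a natural number, defined for all indices: first the sizes of the
    preceding blocks, then the lexicographic offset. *)
Definition std_pos i a b : nat :=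
  (\sum_(j < r | (j < i)%N) K_k j * K_m j + (a * m i + b))%N.

Definition std_frame i a b : 'rV[C]_n := unit_row C n (std_pos i a b).

Lemma std_ordE (i : 'I_r) (a : 'I_(K_k i)) (b : 'I_(K_m i)) :
  std_ord a b = std_pos i a b :> nat.
Proof. exact: tagnat.RankEsum. Qed.

Lemma std_ord_surj (l : 'I_n) :
  exists (i : 'I_r) (a : 'I_(K_k i)) (b : 'I_(K_m i)), l = std_ord a b.
Proof.
pose l' := cast_ord (esym (K_sum J)) l; pose i := tagnat.sig1 l'.
have [y El] : exists y, l' = tagnat.Rank i y.
  by exists (tagnat.sig2 l'); rewrite tagnat.sig2K.
have : (0 < K_k i * K_m i)%N := leq_ltn_trans (leq0n y) (ltn_ord y).
rewrite muln_gt0 => /andP[_ m0].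
(* The offset inside block [i] is split into a and b by Euclidean division by m_i. *)
have alt : (y %/ K_m i < K_k i)%N by rewrite ltn_divLR.
have blt : (y %% K_m i < K_m i)%N by rewrite ltn_mod.
exists i, (Ordinal alt), (Ordinal blt); apply/val_inj; rewrite /std_ord /=.
rewrite -[val l]/(val l') El /=; congr (val (tagnat.Rank i _)).
by apply/val_inj; rewrite /= -divn_eq.
Qed.

Lemma in_range_ord i a b : in_range r k m i a b ->
  exists (i' : 'I_r) (a' : 'I_(K_k i')) (b' : 'I_(K_m i')),
    [/\ i = i', a = a' & b = b'].
Proof. by case/and3P=> ir ak bm; exists (Ordinal ir), (Ordinal ak), (Ordinal bm). Qed.

Lemma std_pos_lt i a b : in_range r k m i a b -> (std_pos i a b < n)%N.
Proof. by move=> /in_range_ord[i' [a' [b' [-> -> ->]]]]; rewrite -std_ordE. Qed.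

Lemma std_pos_eq i a b j c d : in_range r k m i a b -> in_range r k m j c d ->
  (std_pos i a b == std_pos j c d) = [&& i == j, a == c & b == d].
Proof.
move=> /in_range_ord[i' [a' [b' [-> -> ->]]]] /in_range_ord[j' [c' [d' [-> -> ->]]]].
rewrite -!std_ordE [LHS]tagnat.eq_Rank; apply/andP/and3P => [[/eqP ij]|[/eqP ij]].
  subst j'; move=> /= /eqP E; have m0 : (0 < K_m i')%N by exact: leq_trans (ltn_ord b').
  have := congr1 (fun x => x %/ K_m i')%N E; have := congr1 (fun x => x %% K_m i')%N E.
  by rewrite /= !modnMDl !divnMDl // !modn_small // !divn_small // !addn0 => -> ->.
move: ij => /val_inj ij; subst j' => /eqP ac /eqP bd; split=> //=.
by rewrite ac bd.
Qed.

Lemma std_frameP : frame r k m std_frame.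
Proof.
have on : orthonormal_frame r k m std_frame.
  move=> i a b j c d rg rg'; rewrite unit_row_dot ?std_pos_lt //.
  by rewrite std_pos_eq.
split=> //; apply/row_matrixP => l; rewrite !rowE mulmx1.
have [i [a [b lE]]] := std_ord_surj l.
have <- : std_frame i a b = delta_mx 0 l by rewrite /std_frame -std_ordE -lE unit_rowE.
by rewrite mul_frame_op //; apply/and3P.
Qed.

Lemma gl_emb_entry_diag (D : forall i : 'I_r, 'M[C]_(K_k i)) i
    (a c : 'I_(K_k i)) (b d : 'I_(K_m i)) :
  gl_emb D (std_ord a b) (std_ord c d) = D i a c *+ (b == d).
Proof.
rewrite castmxE !cast_ordK.
have := submxblock_diag (fun i => tprod (D i) (1%:M : 'M_(K_m i))) i.
move=> /matrixP/(_ (Ordinal (block_pos_lt a b)) (Ordinal (block_pos_lt c d))).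
rewrite mxE => ->; rewrite (@tprod_entry _ _ _ _ _ _ _ a b c d) //.
by rewrite mxE mulr_natr.
Qed.

Lemma gl_emb_entry_off (D : forall i : 'I_r, 'M[C]_(K_k i)) i j
    (a : 'I_(K_k i)) (b : 'I_(K_m i)) (c : 'I_(K_k j)) (d : 'I_(K_m j)) :
  i != j -> gl_emb D (std_ord a b) (std_ord c d) = 0.
Proof.
move=> ij; rewrite castmxE !cast_ordK.
(* The function is [mxdiag] unfolded into its array of blocks, where an off-diagonal block is 0. *)
have := mxblockK (fun i j =>
  (if i == j then conform_mx 0 (tprod (D i) (1%:M : 'M_(K_m i))) else 0)
  : 'M_(K_k i * K_m i, K_k j * K_m j)) i j.
move=> /matrixP/(_ (Ordinal (block_pos_lt a b)) (Ordinal (block_pos_lt c d))).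
by rewrite mxE => ->; rewrite (negbTE ij) mxE.
Qed.

Lemma std_frame_ord (i : 'I_r) (a : 'I_(K_k i)) (b : 'I_(K_m i)) :
  std_frame i a b = delta_mx 0 (std_ord a b).
Proof. by rewrite /std_frame -std_ordE unit_rowE. Qed.

Lemma std_ord_eq (i j : 'I_r) (a : 'I_(K_k i)) (b : 'I_(K_m i))
    (c : 'I_(K_k j)) (d : 'I_(K_m j)) :
  (std_ord a b == std_ord c d) = [&& i == j, a == c :> nat & b == d :> nat].
Proof.
by rewrite -[_ && _](@std_pos_eq i a b j c d) -?std_ordE //; exact/and3P.
Qed.

Lemma sum_std_frame_diag (D : nat -> C) (i : 'I_r) (b : 'I_(K_m i))
    (c : 'I_(K_k i)) (d : 'I_(K_m i)) :
  (\sum_(a < k i) D a *: std_frame i a b) 0 (std_ord c d) = D c *+ (b == d).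
Proof.
rewrite summxE (bigD1 c) //= big1 ?addr0 => [|a ac]; rewrite std_frame_ord !mxE /=.
  by rewrite std_ord_eq !eqxx /= mulr_natr eq_sym.
by rewrite std_ord_eq eqxx /= eq_sym (negbTE (ac : (a : nat) != c)) mulr0.
Qed.

Lemma sum_std_frame_off (D : nat -> C) (i j : 'I_r) (b : 'I_(K_m i))
    (c : 'I_(K_k j)) (d : 'I_(K_m j)) : i != j ->
  (\sum_(a < k i) D a *: std_frame i a b) 0 (std_ord c d) = 0.
Proof.
move=> ij; rewrite summxE big1 // => a _.
by rewrite std_frame_ord !mxE /= std_ord_eq eq_sym (negbTE ij) mulr0.
Qed.

(** Comparing entries at the positions [std_ord] translates the Kronecker description into frame
    language, in which everything else is argued. *)
Lemma gl_JE (M : 'M[C]_n) : gl_J J M <-> gl r k m std_frame M.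
Proof.
split=> [[D _ <-]|[D MD]].
  (* The second Kronecker factor is an identity matrix, so the coefficients are the same for every b
     and can be read off at b = 0. *)
  pose D' i a a' := (std_frame i a 0 *m gl_emb D *m (std_frame i a' 0) ^t*) 0 0.
  exists D'.
  move=> _ _ _ /in_range_ord[i [a [b [-> -> ->]]]].
  have m0 : (0 < K_m i)%N by exact: leq_ltn_trans (ltn_ord b).
  apply/rowP => l; have [j [c [d ->]]] := std_ord_surj l.
  rewrite [in LHS]std_frame_ord -rowE mxE.
  have [ij|ij] := eqVneq i j; last first.
    by rewrite gl_emb_entry_off // (sum_std_frame_off (D' i a)).
  subst j; rewrite gl_emb_entry_diag (sum_std_frame_diag (D' i a)); congr (_ *+ _).
  rewrite /D' (std_frame_ord a (Ordinal m0)) (std_frame_ord c (Ordinal m0)) -rowE.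
  rewrite -unit_rowE mul_row_unit !mxE eqxx gl_emb_entry_diag //.
exists (fun i => \matrix_(a < K_k i, a' < K_k i) D i a a') => //.
apply/matrixP => x y.
have [i [a [b ->]]] := std_ord_surj x; have [j [c [d ->]]] := std_ord_surj y.
have -> : M (std_ord a b) (std_ord c d) = (std_frame i a b *m M) 0 (std_ord c d).
  by rewrite std_frame_ord -rowE mxE.
rewrite MD; last exact/and3P.
have [ij|ij] := eqVneq i j; last first.
  by rewrite gl_emb_entry_off // (sum_std_frame_off (D i a)).
by subst j; rewrite gl_emb_entry_diag (sum_std_frame_diag (D i a)) mxE.
Qed.

End StandardFrame.

(** * Recovering the block sizes from the algebra *)

Section Invariants.
Variables (C : numClosedFieldType) (n : nat).
Implicit Types (r : nat) (k m : nat -> nat) (e : nat -> nat -> nat -> 'rV[C]_n).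

Lemma sum_frame_dot r k m e (f : nat -> C) i b j c d :
  orthonormal_frame r k m e -> (i < r)%N -> (b < m i)%N -> in_range r k m j c d ->
  (\sum_(a < k i) f a *: e i a b) *m (e j c d) ^t* = (f c *+ ((i == j) && (b == d)))%:M.
Proof.
move=> on ir bm rg; have /and3P[jr ck dm] := rg.
have rgi (a : 'I_(k i)) : in_range r k m i a b by apply/and3P.
rewrite mulmx_suml; have [ij|ij] := eqVneq i j; last first.
  by rewrite raddf0 big1 // => a _; rewrite -scalemxAl on // (negbTE ij) raddf0 scaler0.
subst j; rewrite (bigD1 (Ordinal ck)) //= big1 ?addr0 => [|a ac].
  by rewrite -scalemxAl on ?(rgi (Ordinal ck)) // !eqxx /= scale_scalar_mx mulr_natr.
by rewrite -scalemxAl on // [(a : nat) == c](negbTE ac) andbF raddf0 scaler0.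
Qed.

Lemma frame_neq0 r k m e i a b :
  orthonormal_frame r k m e -> in_range r k m i a b -> e i a b != 0.
Proof.
move=> on rg; apply/eqP => e0; have := on _ _ _ _ _ _ rg rg.
rewrite e0 mul0mx !eqxx => /matrixP/(_ 0 0)/eqP.
by rewrite !mxE eq_sym oner_eq0.
Qed.

Lemma gl_swap_eq r k m e r' k' m' e' : frame r k m e -> frame r' k' m' e' ->
  (forall x, gl r k m e x <-> gl r' k' m' e' x) ->
  forall x, gl r m k (swap e) x <-> gl r' m' k' (swap e') x.
Proof.
move=> fe fe' ee' x.
rewrite (gl_commutant _ (frame_swap fe)) (gl_commutant _ (frame_swap fe')).
by split=> cx y /ee'; exact: cx.
Qed.

(** A block of [x] has the form D (x) 1 and also 1 (x) F; comparing coefficients makes both factors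
    the same scalar, namely the entry of [D] at (0, 0). *)
Lemma gl_center r k m e x : frame r k m e ->
  (forall i, (i < r)%N -> (0 < k i)%N && (0 < m i)%N) ->
  gl r k m e x -> gl r m k (swap e) x ->
  exists l : nat -> C,
    forall i a b, in_range r k m i a b -> e i a b *m x = l i *: e i a b.
Proof.
move=> fe pos [D xD] [F xF]; have on := fe.1; have os := (frame_swap fe).1.
have DF i a b c d : in_range r k m i a b -> in_range r k m i c d ->
    D i a c *+ (b == d) = F i b d *+ (a == c).
  move=> rg rg'; have /and3P[ir ak bm] := rg; have /and3P[_ ck dm] := rg'.
  have := sum_frame_dot (D i a) on ir bm rg'; rewrite -xD // eqxx /=.
  have -> : e i a b *m x = \sum_(b' < m i) F i b b' *: swap e i b' a.
    by apply: xF; rewrite in_range_swap.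
  have := sum_frame_dot (F i b) os ir ak (_ : in_range r m k i d c).
  rewrite in_range_swap => /(_ rg'); rewrite eqxx /= => ->.
  by move=> /matrixP/(_ 0 0); rewrite !mxE eqxx.
exists (fun i => D i 0%N 0%N) => i a b rg; have /and3P[ir ak bm] := rg.
have /andP[k0 m0] := pos i ir.
have rgi c d : (c < k i)%N -> (d < m i)%N -> in_range r k m i c d.
  by move=> ? ?; apply/and3P.
rewrite xD // (bigD1 (Ordinal ak)) //= big1 ?addr0 => [|c ca].
  have := DF i 0%N b 0%N b (rgi _ _ k0 bm) (rgi _ _ k0 bm).
  have := DF i a b a b rg rg.
  by rewrite !eqxx !mulr1n => -> ->.
have := DF i a b c b rg (rgi _ _ (ltn_ord c) bm).
by rewrite eqxx mulr1n eq_sym [(c : nat) == a](negbTE ca) => ->; rewrite scale0r.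
Qed.

(** Prescribing the action on frame vectors makes the notion invariant under [swap], so one
    projection serves both the algebra and its commutant. *)
Definition block_proj r k m e i (p : 'M[C]_n) := forall j c d,
  in_range r k m j c d -> e j c d *m p = ((j == i)%:R) *: e j c d.

Definition central_proj r k m e i : 'M[C]_n :=
  frame_op r k m e (fun j c d => (j == i)%:R *: e j c d).

Lemma central_projP r k m e i : orthonormal_frame r k m e ->
  block_proj r k m e i (central_proj r k m e i).
Proof. by move=> on j c d rg; rewrite mul_frame_op. Qed.

Lemma block_proj_swap r k m e i p :
  block_proj r k m e i p -> block_proj r m k (swap e) i p.
Proof. by move=> bp j d c; rewrite in_range_swap; exact: bp. Qed.

Lemma block_proj_gl r k m e i p : block_proj r k m e i p -> gl r k m e p.
Proof.
move=> bp; exists (fun j c c' => (j == i)%:R *+ (c == c')) => j c d rg.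
have /and3P[jr ck dm] := rg; rewrite bp // (bigD1 (Ordinal ck)) //= eqxx mulr1n.
rewrite big1 ?addr0 // => c' cc'.
by rewrite [c == _]eq_sym [(c' : nat) == c](negbTE cc') scale0r.
Qed.

(* The matrix unit of the i-th block has rank m_i, while every nonzero element of
   the j-th block has rank at least m'_j. *)
Lemma block_mult_le r k m e r' k' m' e' i j p p' (l : C) :
  frame r k m e -> frame r' k' m' e' ->
  (forall x, gl r k m e x -> gl r' k' m' e' x) ->
  block_proj r k m e i p -> block_proj r' k' m' e' j p' ->
  (i < r)%N -> (0 < k i)%N -> (0 < m i)%N -> (j < r')%N ->
  p *m p' = l *: p -> l != 0 -> (m' j <= m i)%N.
Proof.
move=> fe fe' ee' bp bp' ir ki mi jr' pp' l0; have on := fe.1; have on' := fe'.1.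
(* [q] is the projection onto the span of the [e i 0 b], of rank at most m_i. *)
pose q := frame_unit r m k (swap e) i 0 0.
have qE a b c : in_range r k m a c b ->
    e a c b *m q = if (a == i) && (c == 0%N) then e a 0%N b else 0.
  by rewrite -in_range_swap => rg; rewrite [LHS](mul_frame_op _ (frame_swap fe).1 rg).
have rg0 : in_range r k m i 0 0 by apply/and3P.
have gq : gl r k m e q.
  exact: (@frame_unit_gl _ _ r m k (swap e) i 0 0 (frame_swap fe).1 ki).
have [D qD] := ee' _ gq.
have pq : p *m q = q.
  apply: (frame_eq fe) => a c b rg; rewrite mulmxA bp // -scalemxAl qE //.
  by case: eqP => _; rewrite ?scale1r ?scale0r.
(* If all coefficients of [q] in block [j] vanished, then p' q = 0, and p p' = l p with p q = q
   would give l q = 0. *)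
have [c [c' [ck c'k D0]]] : exists c c', [/\ (c < k' j)%N, (c' < k' j)%N & D j c c' != 0].
  apply/not_existsP => noD.
  have p'q : p' *m q = 0.
    apply: (frame_eq fe') => a c b rg; rewrite mulmxA bp' // -scalemxAl mulmx0.
    case: eqP => [aj|_]; rewrite ?scale0r // scale1r qD // big1 // => c' _.
    subst a; have [->|D0] := eqVneq (D j c c') 0; first by rewrite scale0r.
    have /and3P[_ ck _] := rg.
    by case: (noD c); exists c'; split=> //; exact: ltn_ord.
  have : l *: q = 0 by rewrite -pq scalemxAl -pp' -mulmxA p'q mulmx0.
  move=> /eqP; rewrite scaler_eq0 (negbTE l0) /= => /eqP q0.
  have := qE i 0%N 0%N rg0; rewrite q0 mulmx0 !eqxx /= => /esym/eqP.
  exact/negP/(frame_neq0 on).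
pose T a := \matrix_(d < m' j) e' j a d.
(* Compressing [q] to the copies [c] and [c'] gives a nonzero scalar matrix of size m'_j, which
   bounds the rank of [q] from below. *)
have TqT : T c *m q *m (T c') ^t* = (D j c c')%:M.
  apply/matrixP => d d'.
  have rg (a : nat) (b : 'I_(m' j)) : (a < k' j)%N -> in_range r' k' m' j a b.
    by move=> ?; apply/and3P.
  have -> : (T c *m q *m (T c') ^t*) d d' = (e' j c d *m q *m (e' j c' d') ^t*) 0 0.
    rewrite !mxE; apply: eq_bigr => s _; rewrite !mxE; congr (_ * _).
    by apply: eq_bigr => t _; rewrite !mxE.
  rewrite qD ?rg // (sum_frame_dot _ on') ?rg // !mxE eqxx /=.
  by rewrite val_eqE.
have rq : (\rank q <= m i)%N.
  pose T1 := \matrix_(d < m i) e i 0%N d.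
  have qT : (q <= T1)%MS.
    apply: summx_sub => j' _; apply: summx_sub => b _; apply: summx_sub => a _.
    apply: (submx_trans (submxMl _ _)).
    case: ifP => [/andP[/eqP ji _]|_]; last exact: sub0mx.
    have bm : (b < m i)%N by rewrite -ji ltn_ord.
    have -> : swap e j' b 0%N = row (Ordinal bm) T1 by rewrite rowK /swap /= -ji.
    exact: row_sub.
  exact: leq_trans (mxrankS qT) (rank_leq_row _).
apply: leq_trans rq.
have : \rank (T c *m q *m (T c') ^t*) = m' j.
  by rewrite TqT -scalemx1 mxrank_scale_nz // mxrank1.
move=> <-; apply: leq_trans (mxrankM_maxl _ _) (mxrankM_maxr _ _).
Qed.

(** The projection [p'] is central in the common algebra, hence scalar on each block of the first
    frame. *)
Lemma block_overlap r k m e r' k' m' e' i j :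
  frame r k m e -> frame r' k' m' e' ->
  (forall i, (i < r)%N -> (0 < k i)%N && (0 < m i)%N) ->
  (forall x, gl r k m e x <-> gl r' k' m' e' x) -> (i < r)%N ->
  let p := central_proj r k m e i in let p' := central_proj r' k' m' e' j in
  comm_mx p p' /\ exists l, p *m p' = l *: p.
Proof.
move=> fe fe' pos ee' ir p p'.
have bp := central_projP i fe.1; have bp' := central_projP j fe'.1.
have gp' : gl r k m e p' by apply/ee'/(block_proj_gl bp').
have gsp' : gl r m k (swap e) p'.
  by apply/(gl_swap_eq fe fe' ee')/(block_proj_gl (block_proj_swap bp')).
split.
  by apply/comm_mx_sym/(comm_gl fe) => //; exact: block_proj_gl (block_proj_swap bp).
have [l lE] := gl_center fe pos gp' gsp'; exists (l i).
apply: (frame_eq fe) => a c b rg; rewrite mulmxA bp // -scalemxAl -scalemxAr bp // lE //.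
by case: eqP => [->|_]; rewrite ?scale0r ?scaler0 // !scale1r.
Qed.

(** Sending a block to one whose central projection overlaps with its own is injective and preserves
    the pair of sizes. An arbitrary predicate [P] is carried along so that blocks of every type can
    be counted. *)
Lemma card_block_le r k m e r' k' m' e' (P : nat -> nat -> bool) :
  frame r k m e -> frame r' k' m' e' ->
  (forall i, (i < r)%N -> (0 < k i)%N && (0 < m i)%N) ->
  (forall i, (i < r')%N -> (0 < k' i)%N && (0 < m' i)%N) ->
  (forall x, gl r k m e x <-> gl r' k' m' e' x) ->
  (#|[set i : 'I_r | P (k i) (m i)]| <= #|[set j : 'I_r' | P (k' j) (m' j)]|)%N.
Proof.
move=> fe fe' pos pos' ee'.
have e'e x : gl r' k' m' e' x <-> gl r k m e x by rewrite ee'.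
have see' := gl_swap_eq fe fe' ee'; have se'e := gl_swap_eq fe' fe e'e.
pose p i := central_proj r k m e i; pose p' j := central_proj r' k' m' e' j.
have bp i : block_proj r k m e i (p i) := central_projP i fe.1.
have bp' j : block_proj r' k' m' e' j (p' j) := central_projP j fe'.1.
have p_neq0 (i : 'I_r) : p i != 0.
  have /andP[ki mi] := pos i (ltn_ord i).
  have rg0 : in_range r k m i 0 0 by apply/and3P.
  apply/eqP => p0; have := bp i _ _ _ rg0; rewrite p0 mulmx0 eqxx scale1r => /esym/eqP.
  exact/negP/(frame_neq0 fe.1).
have p'_neq0 (j : 'I_r') : p' j != 0.
  have /andP[ki mi] := pos' j (ltn_ord j).
  have rg0 : in_range r' k' m' j 0 0 by apply/and3P.
  apply/eqP => p0; have := bp' j _ _ _ rg0; rewrite p0 mulmx0 eqxx scale1r => /esym/eqP.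
  exact/negP/(frame_neq0 fe'.1).
(* The projections [p'] of the second frame exhaust C^n, so they cannot all annihilate the nonzero
   [p i]. *)
have overlap (i : 'I_r) : exists j : 'I_r', p i *m p' j != 0.
  apply/not_existsP => no; move/eqP: (p_neq0 i); apply.
  apply: (frame_eq fe') => a c b rg; rewrite mulmx0; have /and3P[ar _ _] := rg.
  have -> : e' a c b = e' a c b *m p' a by rewrite bp' // eqxx scale1r.
  have [cpp _] := block_overlap a fe fe' pos ee' (ltn_ord i).
  rewrite -mulmxA -[p' a *m _]cpp.
  have /negP := no (Ordinal ar); rewrite negbK => /eqP ->.
  by rewrite mulmx0.
have [s sP] := fin_all_exists overlap.
have s_inj : injective s.
  move=> i i' si; apply/eqP; apply: contraT => ii'.
  have [c1 _] := block_overlap (s i) fe fe' pos ee' (ltn_ord i).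
  have [_ [l1 E1]] := block_overlap i fe' fe pos' e'e (ltn_ord (s i)).
  have [c2 _] := block_overlap (s i) fe fe' pos ee' (ltn_ord i').
  have [_ [l2 E2]] := block_overlap i' fe' fe pos' e'e (ltn_ord (s i)).
  (* Distinct blocks have orthogonal projections, whereas both acting on [p' (s i)] as nonzero
     scalars would make the product nonzero. *)
  have pp : p i *m p i' = 0.
    apply: (frame_eq fe) => a c b rg; rewrite mulmxA bp // -scalemxAl bp // mulmx0.
    have [->|_] := eqVneq a i; last by rewrite scale0r.
    by rewrite [(i : nat) == i'](negbTE ii') scale0r scaler0.
  have : l1 * l2 *: p' (s i) = 0.
    by rewrite -scalerA -E2 scalemxAl -E1 -mulmxA [X in _ *m X]pp mulmx0.
  move=> /eqP; rewrite scaler_eq0 mulf_eq0 (negbTE (p'_neq0 _)) orbF => /orP[] /eqP l0.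
    by have := sP i; rewrite [_ *m _]c1 [X in X != _]E1 l0 scale0r eqxx.
  by have := sP i'; rewrite -si [_ *m _]c2 [X in X != _]E2 l0 scale0r eqxx.
have sE (i : 'I_r) : k' (s i) = k i /\ m' (s i) = m i.
  have [c1 [l1 E1]] := block_overlap (s i) fe fe' pos ee' (ltn_ord i).
  have [_ [l2 E2]] := block_overlap i fe' fe pos' e'e (ltn_ord (s i)).
  have l1n : l1 != 0 by apply: contra (sP i) => /eqP l0; rewrite [_ *m _]E1 l0 scale0r.
  have l2n : l2 != 0.
    by apply: contra (sP i) => /eqP l0; rewrite [_ *m _]c1 [X in X == _]E2 l0 scale0r.
  have /andP[ki mi] := pos i (ltn_ord i); have /andP[ki' mi'] := pos' _ (ltn_ord (s i)).
  have bsp := block_proj_swap (bp i); have bsp' := block_proj_swap (bp' (s i)).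
  have fs := frame_swap fe; have fs' := frame_swap fe'.
  have M1 := block_mult_le fe fe' (fun x => (ee' x).1) (bp i) (bp' (s i))
    (ltn_ord i) ki mi (ltn_ord (s i)) E1 l1n.
  have M2 := block_mult_le fe' fe (fun x => (ee' x).2) (bp' (s i)) (bp i)
    (ltn_ord (s i)) ki' mi' (ltn_ord i) E2 l2n.
  (* Passing to the commutants exchanges the roles of k and m, so the rank bound for m also yields
     the one for k. *)
  have K1 := block_mult_le fs fs' (fun x => (see' x).1) bsp bsp'
    (ltn_ord i) mi ki (ltn_ord (s i)) E1 l1n.
  have K2 := block_mult_le fs' fs (fun x => (see' x).2) bsp' bsp
    (ltn_ord (s i)) mi' ki' (ltn_ord i) E2 l2n.
  by split; apply/eqP; rewrite eqn_leq ?K1 ?K2 ?M1 ?M2.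
rewrite -(card_imset _ s_inj).
apply/subset_leq_card/fintype.subsetP => j /finset.imsetP[ i + ->].
by rewrite !inE => Pi; have [-> ->] := sE i.
Qed.

End Invariants.

(** * Conjugacy classes and centralizers in a group *)

Section Conjugation.
Variable G : groupType.
Implicit Types (H K : set G) (g x : G).

Lemma conj_setE H g x : conj_set H g x <-> H (g * x * g^-1)%g.
Proof.
split=> [[h Hh <-]|Hx]; first by rewrite conjgE !mulgA mulgV mul1g mulgK.
by exists (g * x * g^-1)%g => //; rewrite conjgE !mulgA mulVg mul1g mulgKV.
Qed.

Lemma conj_set_mul H g g' : conj_set (conj_set H g) g' = conj_set H (g * g')%g.
Proof.
by apply/funext => x; apply/propext; rewrite !conj_setE invgM !mulgA.
Qed.

Lemma conj_set1 H : conj_set H 1%g = H.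
Proof. by apply/funext => x; apply/propext; rewrite conj_setE invg1 mulg1 mul1g. Qed.

Lemma conj_class_conj H g : conj_class (conj_set H g) = conj_class H.
Proof.
apply/funext => K; apply/propext; split=> -[g' _ <-].
  by exists (g * g')%g => //; rewrite conj_set_mul.
by exists (g^-1 * g')%g => //; rewrite conj_set_mul mulgA mulgV mul1g.
Qed.

Lemma conj_class_eq H K : conj_class H = conj_class K -> exists g, K = conj_set H g.
Proof.
move=> HK; have : conj_class H K by rewrite HK; exists 1%g => //; exact: conj_set1.
by case=> g _ <-; exists g.
Qed.

Lemma centralizer_subgroup K : subgroup (centralizer K).
Proof.
split=> [|x y].
  by rewrite inE => h _; exact/commute_sym/commute1.
rewrite !inE => cx cy h Kh; apply: commute_sym; apply: commuteM.
  exact/commute_sym/cx.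
exact/commuteV/commute_sym/cy.
Qed.

End Conjugation.

(** * Renumbering the blocks of a frame *)

Section FramePerm.
Variables (C : numClosedFieldType) (n r : nat).
Implicit Types (k m : nat -> nat) (e : nat -> nat -> nat -> 'rV[C]_n).

Definition frame_perm (s : 'S_r) k m e k' m' e' := forall i : 'I_r,
  [/\ k' i = k (s i), m' i = m (s i) & forall a b, e' i a b = e (s i) a b].

Lemma frame_perm_inv s k m e k' m' e' :
  frame_perm s k m e k' m' e' -> frame_perm (s^-1)%g k' m' e' k m e.
Proof.
move=> h i; have [kE mE eE] := h ((s^-1)%g i).
by rewrite kE mE permKV; split=> // a b; rewrite eE permKV.
Qed.

Lemma frame_perm_frame s k m e k' m' e' :
  frame_perm s k m e k' m' e' -> frame r k m e -> frame r k' m' e'.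
Proof.
move=> h [on e1]; split.
  move=> i a b j c d /and3P[ir ak bm] /and3P[jr ck dm].
  have [kE mE eE] := h (Ordinal ir); have [kE' mE' eE'] := h (Ordinal jr).
  rewrite [e' i a b](eE a b) [e' j c d](eE' c d) on.
  - rewrite val_eqE (inj_eq (@perm_inj _ s)) //.
  - by apply/and3P; split=> //; [rewrite -kE|rewrite -mE].
  - by apply/and3P; split=> //; [rewrite -kE'|rewrite -mE'].
rewrite -e1 /frame_op [RHS](reindex_inj (@perm_inj _ s)) /=.
apply: eq_bigr => i _; have [-> -> eE] := h i.
by apply: eq_bigr => a _; apply: eq_bigr => b _; rewrite eE.
Qed.

Lemma frame_perm_gl s k m e k' m' e' x :
  frame_perm s k m e k' m' e' -> gl r k m e x -> gl r k' m' e' x.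
Proof.
move=> h [D xD].
(* [insub] turns a natural number below [r] into an ordinal on which [s] acts; the default 0 is
   never reached in range. *)
exists (fun i a a' => if insub i is Some i' then D (s i' : 'I_r) a a' else 0).
move=> i a b /and3P[ir ak bm]; have [kE mE eE] := h (Ordinal ir).
rewrite insubT /= [e' i a b](eE a b) xD.
  rewrite -kE; apply: eq_bigr => a' _; congr (_ *: _); rewrite -eE //.
by apply/and3P; split=> //; [rewrite -kE|rewrite -mE].
Qed.

End FramePerm.

(** * Howe subgroups of SU(n) and the subgroups SU(J) *)

Section HoweSU.
Variables (R : realType) (n : nat) (n_gt0 : (0 < n)%N).
Local Notation C := R[i].
Local Notation ks J := (nth 0%N (K_val J).1).
Local Notation ms J := (nth 0%N (K_val J).2).
Implicit Types (r : nat) (k m : nat -> nat) (e : nat -> nat -> nat -> 'rV[C]_n).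

Lemma SU_conjE (g x : SU R n) :
  SU_val (g * x * g^-1)%g = SU_val g *m SU_val x *m (SU_val g) ^t*.
Proof.
have ug : SU_val g \is unitarymx by case: (g) => A AP; have /andP[] := AP.
by rewrite -(invmx_unitary ug).
Qed.

Lemma SU_commute (g x : SU R n) : commute g x <-> comm_mx (SU_val g) (SU_val x).
Proof.
by split=> [/(congr1 (@SU_val R n))//|gx]; apply/val_inj.
Qed.

(** The unitary change of frame is brought to determinant 1 by a phase, which cancels in the
    conjugation. *)
Lemma frame_SU_conj r k m e e' : frame r k m e -> frame r k m e' ->
  exists g : SU R n, forall x : SU R n,
    gl r k m e' (SU_val x) <-> gl r k m e (SU_val (g * x * g^-1)%g).
Proof.
move=> fe fe'; have [U uU ee'] := frame_change fe fe'.
have [a na gP] := unitary_rescale n_gt0 uU.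
exists (MkSU gP) => x; rewrite SU_conjE /= (gl_conj (e := e) _ uU) //.
by rewrite adjmxZ -!scalemxAl -scalemxAr scalerA mulrC -normCKC na expr1n scale1r.
Qed.

Lemma SU_JE (J : K n) (x : SU R n) : SU_J R J x <->
  gl (K_len J) (ks J) (ms J) (std_frame R J) (SU_val x).
Proof. exact: gl_JE. Qed.

(** Any [y] commuting with the second algebra commutes with the special unitary elements of the
    first, hence with all of the first; the double commutant property concludes. *)
Lemma gl_of_SU r k m e r' k' m' e' : frame r k m e -> frame r' k' m' e' ->
  (forall u : SU R n, gl r k m e (SU_val u) -> gl r' k' m' e' (SU_val u)) ->
  forall x, gl r k m e x -> gl r' k' m' e' x.
Proof.
move=> fe fe' ee' x /(gl_commutant _ fe) cx; apply/(gl_commutant _ fe') => y gy.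
apply: special_unitary_commutant cx => //; first exact/gl_selfadj/frame_swap.
move=> u uu du /(gl_commutant _ fe) gu.
have uP : is_SU u by rewrite /is_SU uu du eqxx.
exact/comm_mx_sym/(comm_gl fe')/gy/(ee' (MkSU uP)).
Qed.

Lemma K_pos (J : K n) i : (i < K_len J)%N ->
  (0 < ks J i)%N && (0 < ms J i)%N.
Proof.
case: J => -[k m] /= JP ir; have /and5P[/eqP /= szE _ kP mP _] := JP.
by rewrite !(all_nthP 0%N _) // -szE.
Qed.

Lemma K_size (J : K n) : size (K_val J).1 = size (K_val J).2.
Proof. by case: J => J JP; have /and5P[/eqP] := JP. Qed.

Lemma count_zip_K (J : K n) (P : pred (nat * nat)) :
  count P (zip (K_val J).1 (K_val J).2) =
  #|[set i : 'I_(K_len J) | P (ks J i, ms J i)]|.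
Proof.
have sz : size (zip (K_val J).1 (K_val J).2) = K_len J by rewrite size1_zip // K_size.
rewrite -sum1_count (big_nth (0, 0)%N) sz big_mkord -sum1_card.
by apply: eq_bigl => i; rewrite inE nth_zip // K_size.
Qed.

(** The centralized set is the special unitary part of the commutant of gl(J, C); it has the same
    commutant as the whole of it. *)
Lemma SU_J_Howe (J : K n) : Howe_subgroup (SU_J R J).
Proof.
have fJ := std_frameP R J.
suff -> : SU_J R J = centralizer [set g | gl (K_len J) (ms J)
    (ks J) (swap (std_frame R J)) (SU_val g)]%classic.
  by split; [exact: centralizer_subgroup|eexists].
apply/funext => x; apply/propext; rewrite SU_JE; split=> [gx h gh|cx].
  exact/SU_commute/(comm_gl fJ).
apply/(gl_commutant _ fJ) => y /(gl_commutant _ (frame_swap fJ)) cy.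
apply/comm_mx_sym; apply: special_unitary_commutant cy => //; first exact: gl_selfadj fJ.
move=> u uu du /(gl_commutant _ (frame_swap fJ)) gu.
have uP : is_SU u by rewrite /is_SU uu du eqxx.
by have /SU_commute := cx (MkSU uP) gu.
Qed.

(** Permuting the blocks of the standard frame of [J] keeps its algebra and gives it the shape of
    [J']; frames of equal shape are conjugate under SU(n). *)
Lemma SU_J_sim (J J' : K n) :
  K_sim J J' -> conj_class (SU_J R J') = conj_class (SU_J R J).
Proof.
case/existsP => s /eqP J'E.
pose r := K_len J.
pose e i a b := if insub i is Some i' then std_frame R J (s i' : 'I_r) a b else 0.
have rE : K_len J' = r by rewrite /K_len J'E size_map size_enum_ord.
have h : frame_perm s (ks J) (ms J) (std_frame R J)
    (ks J') (ms J') e.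
  move=> i; rewrite J'E.
  by split=> [||a b]; rewrite ?[LHS](nth_map i) ?size_enum_ord ?nth_ord_enum // /e valK.
have fJ := std_frameP R J; have fJ' := std_frameP R J'.
have fe := frame_perm_frame h fJ; rewrite rE in fJ'.
have [g gE] := frame_SU_conj fe fJ'.
rewrite -(conj_class_conj (SU_J R J) g); congr conj_class.
apply/funext => x; apply/propext; rewrite conj_setE !SU_JE rE gE.
by split; apply: frame_perm_gl; first exact: frame_perm_inv h.
Qed.

Lemma SU_J_inj (J J' : K n) :
  conj_class (SU_J R J) = conj_class (SU_J R J') -> K_sim J J'.
Proof.
move=> /conj_class_eq[g gE].
have fJ := std_frameP R J; have fJ' := std_frameP R J'.
(* Transporting the standard frame of [J] by [g] turns conjugate groups into equal ones. *)
pose e i a b := std_frame R J i a b *m SU_val g.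
have ug : SU_val g \is unitarymx by case: (g) => A AP; have /andP[] := AP.
have fe : frame (K_len J) (ks J) (ms J) e.
  exact: frame_unitary.
have ee' (x : SU R n) : gl (K_len J) (ks J) (ms J) e (SU_val x) <->
    gl (K_len J') (ks J') (ms J') (std_frame R J') (SU_val x).
  rewrite -(SU_JE J') gE conj_setE SU_JE SU_conjE; exact: gl_conj.
have all x : gl (K_len J) (ks J) (ms J) e x <->
    gl (K_len J') (ks J') (ms J') (std_frame R J') x.
  by split; apply: gl_of_SU => // u; rewrite ee'.
(* Two lists of pairs agree up to permutation when every predicate has the same count on both. *)
rewrite K_simE; apply/seq.permP => P; rewrite !count_zip_K.
apply/eqP; rewrite eqn_leq; apply/andP; split.
  by apply: (card_block_le (fun a b => P (a, b)) fJ' fe) => [||x];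
    [exact: K_pos|exact: K_pos|rewrite all].
by apply: (card_block_le (fun a b => P (a, b)) fe fJ') => [||x];
  [exact: K_pos|exact: K_pos|rewrite all].
Qed.

Lemma Howe_SU_J (H : set (SU R n)) : Howe_subgroup H -> exists J : K n,
  conj_class H = conj_class (SU_J R J).
Proof.
case=> _ [A ->].
(* Adding adjoints makes the set self-adjoint; the centralizer is unchanged because the adjoint of a
   unitary matrix is its inverse. *)
pose S (s : 'M[C]_n) := exists2 h : SU R n, A h & s = SU_val h \/ s = (SU_val h) ^t*.
have sS : selfadj S.
  by move=> s [h Ah [->|->]]; exists h => //; [right|left; rewrite trmxCK].
have inv1 : invariant_proj S 1%:M.
  by split; rewrite ?mulmx1 ?adjmx1 // => s _; exact: comm_mx1.
have [r [k [m [e [pos on e1 Se xe]]]]] := structure sS inv1.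
have fe : frame r k m e by [].
have SE x : commutant S x <-> gl r k m e x.
  split=> [/xe|gx s /Se gs]; first by rewrite mulmx1.
  exact/comm_mx_sym/(comm_gl fe).
have JP : is_K n (mkseq k r, mkseq m r).
  have nE : (\sum_(i < r) nth 0 (mkseq k r) i * nth 0 (mkseq m r) i)%N = n.
    rewrite -[RHS](frame_dim fe); apply: eq_bigr => i _.
    by rewrite !nth_mkseq.
  have posk : all (leq 1) (mkseq k r).
    apply/(all_nthP 0%N) => i; rewrite size_mkseq => ir.
    by rewrite nth_mkseq //; case/andP: (pos i ir).
  have posm : all (leq 1) (mkseq m r).
    apply/(all_nthP 0%N) => i; rewrite size_mkseq => ir.
    by rewrite nth_mkseq //; case/andP: (pos i ir).
  rewrite /is_K /= !size_mkseq eqxx posk posm nE eqxx !andbT /=; apply/andP; split.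
    rewrite lt0n; apply/eqP => r0; move: n_gt0; rewrite -(frame_dim fe) r0 big_ord0 //.
  rewrite -[X in (_ <= X)%N](frame_dim fe) -[X in (X <= _)%N]card_ord -sum1_card.
  by apply: leq_sum => i _; rewrite muln_gt0 pos.
pose J := MkK JP; exists J.
have rJ : K_len J = r by exact: size_mkseq.
(* The sequences of [J] agree with [k] and [m] only below [r], so the frame is transferred along the
   identity permutation. *)
have h : frame_perm (1%g : 'S_r) k m e (ks J) (ms J) e.
  by move=> i; rewrite perm1 !nth_mkseq.
have fJ := std_frameP R J; rewrite rJ in fJ.
have [g gE] := frame_SU_conj fJ (frame_perm_frame h fe).
rewrite -(conj_class_conj (SU_J R J) g); congr conj_class.
apply/funext => x; apply/propext; rewrite conj_setE SU_JE rJ -gE.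
transitivity (gl r k m e (SU_val x)); last first.
  split; apply: frame_perm_gl; first exact: h.
  exact: frame_perm_inv h.
rewrite -SE; split=> [cx s [y Ay]|cx y Ay]; last first.
  by apply/SU_commute/comm_mx_sym/cx; exists y => //; left.
have /SU_commute/comm_mx_sym xy := cx y Ay.
have /andP[uy _] := SU_valP y.
case=> -> //; rewrite -(invmx_unitary uy); apply/comm_mx_sym/comm_mx_inv.
  exact: unitarymx_unit.
exact: comm_mx_sym.
Qed.

End HoweSU.

Theorem theorem4p3 (R : realType) (n : nat) (hn : (1 <= n)%N) :
  exists f : Khat n -> set (set (SU R n)),
    (forall J : K n, f (Khat_pi J) = conj_class (SU_J R J)) /\
    set_bij setT (Howe (SU R n)) f.
Proof.
(* The bijection is defined through chosen representatives; this is independence of the choice. *)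
have fE (J : K n) : conj_class (SU_J R (repr (Khat_pi J))) = conj_class (SU_J R J).
  apply: SU_J_sim => //.
  have /eqmodP : Khat_pi J = \pi_(Khat n) (repr (Khat_pi J)) by rewrite reprK.
  by [].
exists (fun x => conj_class (SU_J R (repr x))); split=> //; split.
- by move=> x _; exists (SU_J R (repr x)) => //; exact: SU_J_Howe.
- move=> x y _ _ /(SU_J_inj hn) xy.
  by rewrite -[x]reprK -[y]reprK; apply/eqmodP.
- move=> _ [H HH <-]; have [J ->] := Howe_SU_J hn HH.
  by exists (Khat_pi J).
Qed.
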